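(* Let $G=(V,E,w)$ be an undirected $n$-vertex graph with non-negative edge weights whose edges (with their weights) are presented in an insertion-only stream. Given a source vertex $s\in V$, an integer $k$ with $1\le k\le \ln n$, and a parameter $\varepsilon\in(0,1)$, there is a randomized streaming algorithm that outputs a $(1+\varepsilon)$-approximate shortest path tree rooted at $s$ using \[ O\!\left(\frac{k}{\varepsilon}\cdot n^{1+1/k}\cdot \log n\right)\ \text{space}\quad\text{and}\quad O\!\left(\frac{k^2}{\varepsilon}\right)\ \text{passes}, \] with probability at least $1-n^{-\Omega(n)}$.
   Context: In the insertion-only streaming model the edges of the graph arrive one by one in an arbitrary order; the algorithm may make several passes over the same stream. Space is measured in machine words of $O(\log n)$ bits (an edge weight is assumed to fit in a word). A $(1+\varepsilon)$-approximate shortest path tree rooted at $s$ is a tree $T\subseteq G$ rooted at $s$ such that $\mathrm{dist}_T(s,t)\le(1+\varepsilon)\,\mathrm{dist}_G(s,t)$ for every vertex $t$, where $\mathrm{dist}$ denotes weighted shortest path distance. *)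

(* Defs.v *)
From HB Require Import structures.
From mathcomp Require Import all_boot all_order all_algebra.
From mathcomp Require Import all_classical all_reals all_analysis.

Set Implicit Arguments.
Unset Strict Implicit.
Unset Printing Implicit Defensive.

Import Order.TTheory GRing.Theory Num.Theory.
Local Open Scope ring_scope.

(** * Undirected weighted graphs *)

Record wgraph (R : realType) (V : finType) := WGraph {
  edges : {set {set V}};
  weight : {set V} -> R;
  edges_card2 : forall e, e \in edges -> #|e| = 2%N;
  weight_ge0 : forall e, e \in edges -> 0 <= weight e }.

Definition adj (V : finType) (E : {set {set V}}) : rel V :=
  fun x y => ([set x; y]%SET \in E).

(* The weight of the walk x :: p *)
Definition walk_weight (R : realType) (V : finType) (w : {set V} -> R)
    (x : V) (p : seq V) : R :=
  \sum_(e <- pairmap (fun a b => [set a; b]%SET) x p) w e.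

(* The infimum is +oo when y is not reachable from x; otherwise it is a minimum,
   since weights are nonnegative. *)
Definition dist (R : realType) (V : finType) (E : {set {set V}})
    (w : {set V} -> R) (x y : V) : \bar R :=
  ereal_inf [set z | exists p : seq V,
    [/\ path (adj E) x p, last x p = y & z = (walk_weight w x p)%:E]]%classic.

(* A graph (not necessarily spanning V) given by its vertex and edge sets *)
Definition graph_on (V : finType) : Type := ({set V} * {set {set V}})%type.

(* The size bound in the last clause excludes the closed walks [:: x; y] that
   traverse one edge back and forth. *)
Definition is_tree (V : finType) (T : graph_on V) : Prop :=
  [/\ T.1 != finset.set0,
      forall e, e \in T.2 -> #|e| = 2%N /\ e \subset T.1,
      {in T.1 &, forall x y, connect (adj T.2) x y}
    & forall c : seq V, uniq c -> (2 < size c)%N -> ~~ cycle (adj T.2) c].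

Definition approx_spt (R : realType) (V : finType) (G : wgraph R V) (s : V)
    (eps : R) (T : graph_on V) : Prop :=
  [/\ is_tree T, s \in T.1, T.2 \subset edges G
    & forall t, (dist T.2 (weight G) s t <=
                 (1 + eps)%:E * dist (edges G) (weight G) s t)%E].

(** * Finite probability distributions *)

Record fdist (R : realType) (T : finType) := FDist {
  pmf :> T -> R;
  pmf_ge0 : forall x, 0 <= pmf x;
  pmf_sum1 : \sum_x pmf x = 1 }.

Section FDist.
Variables (R : realType) (T U : finType).

Lemma fdirac_ge0 (a x : T) : 0 <= (x == a)%:R :> R.
Proof. exact: ler0n. Qed.

Lemma fdirac_sum1 (a : T) : \sum_x (x == a)%:R = 1 :> R.
Proof. by rewrite (bigD1 a) //= eqxx big1 ?addr0 // => i /negPf ->. Qed.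

Definition fdirac (a : T) : fdist R T := FDist (fdirac_ge0 a) (fdirac_sum1 a).

Lemma fbind_ge0 (p : fdist R T) (f : T -> fdist R U) (y : U) :
  0 <= \sum_x p x * f x y.
Proof. by apply: sumr_ge0 => x _; apply: mulr_ge0; apply: pmf_ge0. Qed.

Lemma fbind_sum1 (p : fdist R T) (f : T -> fdist R U) :
  \sum_y \sum_x p x * f x y = 1.
Proof.
rewrite exchange_big /= -[RHS](pmf_sum1 p).
by apply: eq_bigr => x _; rewrite -mulr_sumr pmf_sum1 mulr1.
Qed.

Definition fbind (p : fdist R T) (f : T -> fdist R U) : fdist R U :=
  FDist (fbind_ge0 p f) (fbind_sum1 p f).

Definition Pr (p : fdist R T) (A : T -> Prop) : R :=
  \sum_(x | `[< A x >]) p x.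
End FDist.

(** * Insertion-only multi-pass streaming *)

Definition word (b : nat) : finType := b.-tuple bool.

(* An edge together with the word that encodes its weight *)
Definition item (V : finType) (b : nat) : finType := ({set V} * word b)%type.

(* Between consecutive items everything the algorithm remembers, including its
   position in the computation and any coin tosses it wants to use again, is held
   in sa_space words of b bits.  Each transition uses fresh randomness.  The end
   of a pass is signalled to the algorithm by sa_end_pass. *)
Record stream_alg (R : realType) (V : finType) (b : nat) := StreamAlg {
  sa_space : nat;
  sa_passes : nat;
  sa_init : sa_space.-tuple (word b);
  sa_step : item V b -> sa_space.-tuple (word b) ->
            fdist R (sa_space.-tuple (word b) : finType);
  sa_end_pass : sa_space.-tuple (word b) ->
                fdist R (sa_space.-tuple (word b) : finType);
  sa_output : sa_space.-tuple (word b) -> graph_on V }.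

Section Run.
Variables (R : realType) (V : finType) (b : nat) (A : stream_alg R V b).
Notation mem := ((sa_space A).-tuple (word b) : finType).

Definition run_pass (sigma : seq (item V b)) (mu : fdist R mem) : fdist R mem :=
  fbind (foldl (fun nu i => fbind nu (@sa_step _ _ _ A i)) mu sigma)
        (@sa_end_pass _ _ _ A).

(* Every pass reads the same stream. *)
Definition run (sigma : seq (item V b)) : fdist R mem :=
  iter (sa_passes A) (run_pass sigma) (fdirac R (sa_init A)).
End Run.

(* sigma lists every edge of G exactly once, in an arbitrary order, with a word
   that encodes its weight in the number format val. *)
Definition stream_of (R : realType) (V : finType) (b : nat) (val : word b -> R)
    (G : wgraph R V) (sigma : seq (item V b)) : Prop :=
  perm_eq (unzip1 sigma) (enum (edges G)) /\
  forall i, i \in sigma -> val i.2 = weight G i.1.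

(* c * ceil (log2 n) bits *)
Definition word_size (c n : nat) : nat := (c * up_log 2 n)%N.

(* Main.v *)
(** The algorithm first builds, deterministically and in [k] passes, a spanner [H] of
    stretch [K = 2k - 1] in the manner of Baswana and Sen; random sampling of
    clusters is replaced by a greedy hitting set, each vertex keeping its [q] lightest
    edges to distinct clusters.  It then runs [r = O(k^2 / eps)] rounds of importance
    sampling.  Each round samples about [(r / k) n^(1 + 1/k) log n] edges, with
    probabilities proportional to their importances, and stores a shortest path
    tree [T] of the sample together with [H].  An edge [uv] is violated when
    [dist_T(s, v) > dist_T(s, u) + w(uv)]; its importance is then multiplied by
    [n^(1/k)].  No sampled edge is violated, so by a union bound over all trees the
    violated edges carry at most a fraction [k / (r n^(1/k))] of the total importance,
    except with probability [n^(-Omega(n))].  Hence the total importance stays below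
    [n^2 (1 + k/r)^r <= n^3], and no edge is violated in more than [3k] rounds.
    Because of [H], a violated edge stretches a path by a factor at most [K]; so if some
    vertex [t] were worse than [1 + eps] in every round, the edges of the shortest path
    to [t] would be violated, on average by weight, in more than [r eps / (K - 1) >= 3k]
    rounds.  So the union of the [r] stored trees contains a [(1 + eps)]-approximate path to
    every vertex, and a shortest path tree of this union is output. *)
Require Import Defs.
From HB Require Import structures.
From mathcomp Require Import all_boot all_order all_algebra.
From mathcomp Require Import all_classical all_reals all_analysis.
From mathcomp Require Import ring lra.

Set Implicit Arguments.
Unset Strict Implicit.
Unset Printing Implicit Defensive.

Import Order.TTheory GRing.Theory Num.Theory.
Local Open Scope ring_scope.

(** * Attaching a leaf to a tree *)

Section Trees.
Variable V : finType.
Implicit Types (E : {set {set V}}) (X : {set V}).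

Lemma adj_sym E : symmetric (adj E).
Proof. by move=> x y; rewrite /adj finset.setUC. Qed.

Lemma adj_leaf E X x y z : (forall e, e \in E -> e \subset X) -> y \notin X ->
  adj ([set x; y]%SET |: E) y z -> z = x.
Proof.
move=> EX yX; rewrite /adj !inE => /orP[/eqP yz|/EX/fintype.subsetP/(_ y)]; last first.
  by rewrite !inE eqxx (negPf yX) => /(_ isT).
have : x \in [set y; z]%SET by rewrite yz !inE eqxx.
rewrite !inE => /orP[|] /eqP xE //; move: yz; rewrite xE => yz.
have : z \in [set y; y]%SET by rewrite -yz !inE eqxx orbT.
by rewrite !inE orbb => /eqP.
Qed.

Lemma is_tree_leaf E X x y : is_tree (X, E) -> x \in X -> y \notin X ->
  is_tree (y |: X, [set x; y]%SET |: E).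
Proof.
case=> /= X0 EX con acy xX yX.
have xy : x != y by apply: contraNneq yX => <-.
have EX' e : e \in E -> e \subset X by case/EX.
have cE a c : connect (adj E) a c -> connect (adj ([set x; y]%SET |: E)) a c.
  apply: connect_sub => u v uv; apply: connect1.
  by move: uv; rewrite /adj !inE => ->; rewrite orbT.
have csym := sym_connect_sym (adj_sym ([set x; y]%SET |: E)).
split=> /=.
- by apply/finset.set0Pn; exists y; rewrite !inE eqxx.
- move=> e; rewrite !inE => /orP[/eqP ->|/EX[-> eX]].
    by rewrite cards2 xy; split=> //; apply/fintype.subsetP => z; rewrite !inE
       => /orP[] /eqP ->; rewrite ?xX ?orbT ?eqxx.
  by split=> //; apply: fintype.subset_trans eX _; apply: finset.subsetUr.
- have cx a : a \in y |: X -> connect (adj ([set x; y]%SET |: E)) x a.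
    rewrite !inE => /orP[/eqP ->|aX]; last exact/cE/con.
    by apply: connect1; rewrite /adj !inE eqxx.
  move=> a c /cx xa /cx xc; apply: connect_trans xc.
  by rewrite csym.
(* A cycle through the leaf [y], rotated to start there, has [x] both as its second and as its last
   vertex, against [uniq]. Any other cycle avoids the new edge. *)
- move=> c uc sc; apply/negP => cc; case: (boolP (y \in c)) => yc.
    have [i p cE'] := rot_to yc.
    move: uc sc cc; rewrite -(rot_uniq i) -(size_rot i) -(rot_cycle i) cE' {cE'}.
    case: p => [//|a [//|a' p]] /= /and3P[_ + _] _; rewrite !rcons_path.
    move=> aN /and3P[/(adj_leaf EX' yX) ax _ /andP[_]].
    rewrite adj_sym => /(adj_leaf EX' yX) lx.
    by move: aN; rewrite ax -lx mem_last.
  move: (acy c uc sc); rewrite (_ : cycle (adj E) c) //.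
  apply: (sub_in_cycle (P := mem c) _ _ cc); last exact/allP.
  move=> u v uC vC; rewrite /adj !inE => /orP[/eqP uv|//].
  have : y \in [set u; v]%SET by rewrite uv !inE eqxx orbT.
  by rewrite !inE => /orP[] /eqP yE; move: yc; rewrite yE ?uC ?vC.
Qed.

Lemma is_tree1 (x : V) : is_tree ([set x]%SET, finset.set0).
Proof.
split=> /=; first by apply/finset.set0Pn; exists x; rewrite inE.
- by move=> e; rewrite inE.
- by move=> a c; rewrite !inE => /eqP -> /eqP ->; apply: connect0.
- by case=> [//|a [//|a' p]] _ _; rewrite /= /adj inE.
Qed.

End Trees.

(** * Walks over stored edges, and shortest path trees *)

Section Reach.
Variables (R : realType) (V : finType) (b : nat) (vl : word b -> R).

(** Items that carry a genuine edge: [ends] always has two elements, on which [other_end] relies. *)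
Definition eitem : finType := {i : item V b | #|i.1| == 2%N}.

Definition ends (e : eitem) : {set V} := (val e).1.
Definition wt (e : eitem) : R := vl (val e).2.

(* reach F x y l: some walk from x to y over the items of F has weight at most l *)
Inductive reach (F : seq eitem) : V -> V -> R -> Prop :=
| reach_refl x l : 0 <= l -> reach F x x l
| reach_cons e x y z l1 l2 : e \in F -> ends e = [set x; y]%SET ->
    reach F y z l1 -> wt e + l1 <= l2 -> reach F x z l2.

Implicit Types (F T : seq eitem).

Lemma reach_le F x y l l' : reach F x y l -> l <= l' -> reach F x y l'.
Proof.
move=> r; elim: r l' => [z m m0|e u v z l1 l2 eF eE _ IH le1] l' le2.
  by apply: reach_refl; apply: le_trans le2.
by apply: (reach_cons eF eE (IH _ (lexx _))); apply: le_trans le2.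
Qed.

Lemma reach_sub F T x y l : {subset F <= T} -> reach F x y l -> reach T x y l.
Proof.
move=> FT; elim=> [z m m0|e u v z l1 l2 eF eE _ IH le1].
  exact: reach_refl.
exact: (reach_cons (FT _ eF) eE IH).
Qed.

Lemma reach_trans F y x z l1 l2 :
  reach F x y l1 -> reach F y z l2 -> reach F x z (l1 + l2).
Proof.
move=> r; elim: r => [u m m0|e u v w m1 m2 eF eE _ IH le1] r2.
  by apply: reach_le r2 _; rewrite lerDr.
by apply: (reach_cons eF eE (IH r2)); rewrite addrA lerD2r.
Qed.

Lemma reach1 F e x y : e \in F -> ends e = [set x; y]%SET -> reach F x y (wt e).
Proof.
move=> eF eE; apply: (reach_cons eF eE (reach_refl _ _ (lexx 0))).
by rewrite addr0.
Qed.

Lemma reach_sym F x y l : reach F x y l -> reach F y x l.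
Proof.
elim=> [z m m0|e u v z l1 l2 eF eE _ IH le1]; first exact: reach_refl.
apply: reach_le le1; rewrite addrC; apply: (reach_trans IH).
by apply: reach1 => //; rewrite finset.setUC.
Qed.

Lemma reach_ge0 F x y l :
  (forall e, e \in F -> 0 <= wt e) -> reach F x y l -> 0 <= l.
Proof.
move=> F0; elim=> [//|e u v z l1 l2 eF eE _ IH le1].
by apply: le_trans le1; apply: addr_ge0 => //; apply: F0.
Qed.

Lemma reach_exit F (X : {set V}) x z l :
  (forall e, e \in F -> 0 <= wt e) -> reach F x z l -> x \in X -> z \notin X ->
  exists e u v l', [/\ e \in F, ends e = [set u; v]%SET, u \in X, v \notin X &
    reach F x u l' /\ l' + wt e <= l].
Proof.
move=> F0; elim=> [u m m0 -> //|e u v w l1 l2 eF eE rv IH le1] uX wX.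
have [vX|vX] := boolP (v \in X); last first.
  exists e, u, v, 0; split=> //; split; first exact: reach_refl.
  rewrite add0r; apply: le_trans le1; rewrite lerDl.
  exact: reach_ge0 rv.
have [e' [u' [v' [l' [e'F e'E u'X v'X [ru le']]]]]] := IH vX wX.
exists e', u', v', (wt e + l'); split=> //; split.
  exact: (reach_cons eF eE ru).
by rewrite -addrA; apply: le_trans le1; rewrite lerD2l.
Qed.

(* Dijkstra: grow a tree around s, always by the cheapest leaving edge. *)
Lemma spt_exists F s : (forall e, e \in F -> 0 <= wt e) ->
  exists T X, [/\ {subset T <= F}, (size T <= #|V|)%N,
    is_tree (X, [set ends e | e in T]%SET), s \in X &
    forall v l, reach F s v l -> reach T s v l].
Proof.
move=> F0.
(* [d] is the exact distance from [s] on [X]: [T] attains it and no walk over [F] beats it. *)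
pose inv T (X : {set V}) (d : V -> R) :=
  [/\ {subset T <= F} /\ (size T < #|X|)%N,
     is_tree (X, [set ends e | e in T]%SET), s \in X,
     forall x, x \in X -> reach T s x (d x) &
     forall x l, x \in X -> reach F s x l -> d x <= l].
suff grow m T X d : inv T X d -> (#|~: X| <= m)%N ->
    exists T' X', [/\ {subset T' <= F}, (size T' <= #|V|)%N,
      is_tree (X', [set ends e | e in T']%SET), s \in X' &
      forall v l, reach F s v l -> reach T' s v l].
  apply: (grow _ [::] [set s]%SET (fun=> 0) _ (leqnn _)); split=> //.
  - by rewrite cards1.
  - rewrite (_ : [set _ | _ in _]%SET = finset.set0); first exact: is_tree1.
    by apply/finset.setP => z; rewrite finset.inE; apply/finset.imsetP => -[a]; rewrite in_nil.
  - by rewrite inE.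
  - by move=> x; rewrite inE => /eqP ->; apply: reach_refl.
  - by move=> x l _; apply: reach_ge0.
elim: m T X d => [|m IH] T X d [[TF sT] tr sX up lo] Xm.
  exists T, X; split=> //; first by apply: ltnW; apply: (leq_trans sT (max_card _)).
  move=> v l r; have vX : v \in X.
    by move: Xm; rewrite leqn0 cards_eq0 => /eqP X0; apply/negPn;
      rewrite -finset.in_setC X0 inE.
  by apply: reach_le (up v vX) _; apply: lo.
pose P (c : eitem * V * V) := let: (e, x, y) := c in
  [&& e \in F, ends e == [set x; y]%SET, x \in X & y \notin X].
have [/existsP[c0 Pc0]|/existsPn noP] := boolP [exists c, P c]; last first.
  exists T, X; split=> //; first by apply: ltnW; apply: (leq_trans sT (max_card _)).
  move=> v l r; have [vX|vX] := boolP (v \in X).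
    by apply: reach_le (up v vX) _; apply: lo.
  have [e [u [w [l' [eF eE uX wX _]]]]] := reach_exit F0 r sX vX.
  by move: (noP (e, u, w)); rewrite /P eF eE eqxx uX wX.
pose f (c : eitem * V * V) := d c.1.2 + wt c.1.1.
case: (Order.TotalTheory.arg_minP f Pc0) => -[[e x] y] /and4P[eF /eqP eE xX yX] minc.
pose d' z := if z == y then d x + wt e else d z.
have d'X z : z \in X -> d' z = d z.
  by move=> zX; rewrite /d'; case: eqP => // zy; move: yX; rewrite -zy zX.
apply: (IH (e :: T) (y |: X) d').
  split.
  - split; last by rewrite cardsU1 yX add1n ltnS.
    by move=> z; rewrite inE => /orP[/eqP ->|/TF].
  - rewrite (_ : [set _ | _ in _]%SET = [set x; y]%SET |: [set ends e | e in T]%SET).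
      exact: is_tree_leaf.
    apply/finset.setP => z; rewrite !inE -eE; apply/finset.imsetP/orP.
      move=> [a]; rewrite inE => /predU1P[->|aT] ->; first by rewrite eqxx; left.
      by right; apply/finset.imsetP; exists a.
    case=> [/eqP ->|/finset.imsetP[a aT ->]]; first by exists e; rewrite // inE eqxx.
    by exists a; rewrite // inE aT orbT.
  - by rewrite !inE sX orbT.
  - have sub : {subset T <= e :: T} by move=> z zT; rewrite inE zT orbT.
    move=> z; rewrite !inE => /orP[/eqP ->|zX]; last first.
      by rewrite d'X //; apply: reach_sub (up z zX).
    rewrite /d' eqxx; apply: reach_trans (reach_sub sub (up x xX)) _.
    by apply: reach1; rewrite // inE eqxx.
  - move=> z l; rewrite !inE => /orP[/eqP ->|zX] r; last by rewrite d'X //; apply: lo.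
    rewrite /d' eqxx.
    (* Any walk to [y] leaves [X] by an edge at some [u]. It costs at least [d u] up to there, and
       [e] minimises [d] plus weight over all leaving edges. *)
    have [e' [u [w [l' [e'F e'E uX wX [ru le']]]]]] := reach_exit F0 r sX yX.
    have /minc : P (e', u, w) by rewrite /P e'F e'E eqxx uX wX.
    rewrite /f /= => /le_trans; apply; apply: le_trans le'.
    by rewrite lerD2r; apply: lo.
rewrite -ltnS; apply: leq_trans Xm.
rewrite [X in (_ < X)%N](cardsD1 y) finset.in_setC yX add1n ltnS.
by apply: subset_leq_card; apply/fintype.subsetP => z; rewrite !inE negb_or.
Qed.

End Reach.

(** * Online selection of the lightest items in distinct classes *)

Section Lightest.
Variables (R : realType) (T C : eqType) (cl : T -> C) (w : T -> R) (q : nat).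
Implicit Types (P L : seq T) (e f g : T).

Definition by_weight : rel T := fun f g => w f <= w g.

(* L keeps a lightest item in each of the q lightest classes met so far. *)
Definition insert_lightest e L : seq T :=
  if has (fun f => (cl f == cl e) && (w f <= w e)) L then L
  else take q (sort by_weight (e :: [seq f <- L | cl f != cl e])).

(** The last clause lists the two fates of an edge at a vertex. Either an edge no heavier to the
    same cluster stands in for it, or [q] distinct clusters are adjacent by edges no heavier than
    it, so that a hitting set can be applied. *)
Definition lightest P L :=
  [/\ {subset L <= P}, uniq (map cl L), (size L <= q)%N &
    forall e, e \in P -> (exists2 f, f \in L & cl f = cl e /\ w f <= w e) \/
      (size L = q /\ forall f, f \in L -> w f <= w e)].

Lemma lightest_nil : lightest [::] [::].
Proof. by split. Qed.

Lemma size_insert_lightest e L :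
  (size L <= q)%N -> (size (insert_lightest e L) <= q)%N.
Proof. by rewrite /insert_lightest; case: has => // _; rewrite size_take_min geq_minl. Qed.

Lemma lightest_insert P L e :
  lightest P L -> lightest (rcons P e) (insert_lightest e L).
Proof.
case=> LP uL sL cov; rewrite /insert_lightest.
case: (boolP (has _ _)) => [/hasP[f fL /andP[/eqP fe we]]|/hasPn no].
  split=> //; first by move=> a /LP aP; rewrite mem_rcons inE aP orbT.
  by move=> a; rewrite mem_rcons inE => /predU1P[->|/cov//]; left; exists f.
set L1 := [seq f <- L | cl f != cl e]; set S := sort _ _.
have SE a : (a \in S) = (a == e) || (a \in L1) by rewrite mem_sort inE.
have L1L a : a \in L1 -> a \in L by rewrite mem_filter => /andP[].
have uS : uniq (map cl S).
  rewrite (perm_uniq (perm_map cl (permEl (perm_sort _ _)))) /=.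
  apply/andP; split.
    by apply/mapP => -[f]; rewrite mem_filter => /andP[/eqP fe _] /esym.
  exact: subseq_uniq (map_subseq _ (filter_subseq _ _)) uL.
have pS : pairwise by_weight S.
  rewrite -sorted_pairwise; last by move=> x y z; apply: le_trans.
  by apply: sort_sorted => x y; apply: le_total.
have dropS a : a \in drop q S ->
    (q < size S)%N /\ forall f, f \in take q S -> w f <= w a.
  move=> aD; split.
    by rewrite ltnNge; apply/negP => /drop_oversize d0; rewrite d0 in aD.
  move=> f fT; move: pS; rewrite -{1}(cat_take_drop q S) pairwise_cat.
  by case/andP => /allrelP/(_ _ _ fT aD).
have sizeq a : a \in drop q S -> size (take q S) = q.
  by case/dropS=> lt _; rewrite size_takel // ltnW.
have main g : g \in S -> g \in take q S \/
    (size (take q S) = q /\ forall f, f \in take q S -> w f <= w g).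
  rewrite -{1}(cat_take_drop q S) mem_cat => /orP[|gD]; first by left.
  by right; split; [apply: sizeq gD|case: (dropS _ gD)].
have use g a : g \in S -> cl g = cl a -> w g <= w a ->
    (exists2 f, f \in take q S & cl f = cl a /\ w f <= w a) \/
    (size (take q S) = q /\ forall f, f \in take q S -> w f <= w a).
  move=> /main[gT|[sT le]] ga wga; [left|right]; first by exists g.
  by split=> // f /le /le_trans; apply.
split.
- move=> a /mem_take; rewrite SE mem_rcons inE => /orP[->//|/L1L/LP ->].
  by rewrite orbT.
- by rewrite map_take take_uniq.
- by rewrite size_take_min geq_minl.
move=> a; rewrite mem_rcons inE => /predU1P[->|].
  by apply: (use e) => //; rewrite SE eqxx.
move=> /cov[[f fL [fa wfa]]|[Lq le]].
  have [fe|fe] := eqVneq (cl f) (cl e); last first.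
    by apply: (use f) => //; rewrite SE mem_filter fe fL orbT.
  apply: (use e); rewrite ?SE ?eqxx //; first by rewrite -fe.
  move: (no f fL); rewrite fe eqxx /= -ltNge => /ltW /le_trans; exact.
right.
(* Classes in [L] are distinct, so filtering out the class of [e] loses at most one item, and [e]
   itself makes up for it. *)
have sS : (q <= size S)%N.
  rewrite size_sort /= size_filter -Lq -(count_predC (fun f => cl f == cl e) L).
  rewrite -add1n leq_add2r -(count_map cl (pred1 (cl e))) count_uniq_mem //.
  exact: leq_b1.
split; first by rewrite size_takel.
move=> f fT; move: (mem_take fT); rewrite SE => /orP[/eqP fe|/L1L/le //].
have [/hasP[f0 f0L /eqP f0e]|/hasPn noc] := boolP (has (fun f => cl f == cl e) L).
  apply: le_trans (le _ f0L); move: (no _ f0L).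
  by rewrite f0e eqxx fe /= -ltNge => /ltW.
have L1E : L1 = L by apply/all_filterP/allP.
(* The class of [e] is new and [L] was full, so some [g] is dropped from [S]. If [e] is kept, then
   [g] comes from [L] and is at least as heavy as [e], hence [w e <= w g <= w a]. *)
have : (0 < size (drop q S))%N.
  by rewrite size_drop size_sort /= L1E Lq subSnn.
case dE : (drop q S) => [//|g D] _.
have gD : g \in drop q S by rewrite dE inE eqxx.
apply: le_trans (proj2 (dropS _ gD) _ fT) _.
move: (mem_drop gD); rewrite SE => /orP[/eqP ge|/L1L/le//].
move: (map_uniq uS); rewrite -{1}(cat_take_drop q S) cat_uniq => /and3P[_ /hasPn].
by move=> /(_ _ gD); rewrite ge -fe fT.
Qed.

End Lightest.

(** * Greedy hitting sets *)

Section Hitting.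
Variables (R : realType) (V : finType) (C D : {set V}) (U : V -> {set V}) (q : nat).
Hypothesis UC : forall u, u \in D -> U u \subset C.
Hypothesis Uq : forall u, u \in D -> (q <= #|U u|)%N.

Definition missed (Hs : {set V}) : {set V} :=
  [set u in D | [disjoint U u & Hs]]%SET.

(** Double counting: the missed sets have at least [q] elements each in [C], so an average element
    of [C] lies in a fraction [q / #|C|] of them. *)
Lemma missed_average (Hs : {set V}) : (0 < #|C|)%N -> exists c,
  #|missed (c |: Hs)|%:R <= (1 - q%:R / #|C|%:R) * #|missed Hs|%:R :> R.
Proof.
move=> C0; set rem := missed Hs.
pose hit c := [set u in rem | c \in U u]%SET.
have missE c : #|missed (c |: Hs)|%:R = #|rem|%:R - #|hit c|%:R :> R.
  rewrite -(cardsID [set u | c \in U u]%SET rem) natrD.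
  rewrite (_ : rem :&: _ = hit c); last by apply/finset.setP => u; rewrite !inE.
  rewrite [X in _ = X - _]addrC addrK; congr (#|pred_of_set _|%:R).
  apply/finset.setP => u; rewrite !inE.
  rewrite -!setI_eq0 finset.setIUr finset.setU_eq0 setI_eq0 disjoint_sym disjoints1.
  by rewrite andbCA.
have [/existsP[c qc]|/existsPn no] :=
    boolP [exists c, (q%:R * #|rem|%:R <= #|hit c|%:R * #|C|%:R :> R)].
  exists c; rewrite missE mulrBl mul1r lerD2l lerN2 mulrAC.
  by rewrite ler_pdivrMr ?ltr0n.
exfalso.
have : \sum_(c in C) #|hit c|%:R * #|C|%:R < \sum_(c in C) q%:R * #|rem|%:R :> R.
  apply: ltr_sum; first by apply/hasP; case/card_gt0P: C0 => c cC; exists c;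
    rewrite ?mem_index_enum.
  by move=> c _; rewrite ltNge.
rewrite -mulr_suml sumr_const -[X in _ < X]mulr_natr ltr_pM2r ?ltr0n // ltNge => /negP.
apply; rewrite -natr_sum -natrM ler_nat.
have -> : (\sum_(c in C) #|hit c| = \sum_(u in rem) #|U u|)%N.
  under eq_bigr => c _ do rewrite -sum1_card.
  rewrite (exchange_big_dep (mem rem)) /=; last first.
    by move=> c u _; rewrite inE => /andP[].
  apply: eq_bigr => u uR; rewrite -[RHS]sum1_card; apply: eq_bigl => c.
  rewrite inE uR /=; apply: andb_idl => /(fintype.subsetP (UC _)); apply.
  by move: uR; rewrite inE => /andP[].
rewrite mulnC -sum_nat_const; apply: leq_sum => u; rewrite inE => /andP[uD _].
exact: Uq.
Qed.

Lemma hitting_set m : (0 < #|C|)%N -> (q <= #|C|)%N -> exists Hs : {set V},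
  (#|Hs| <= m)%N /\ #|missed Hs|%:R <= (1 - q%:R / #|C|%:R) ^+ m * #|V|%:R :> R.
Proof.
move=> C0 qC; elim: m => [|m [Hs [sH mH]]].
  exists finset.set0; rewrite cards0; split=> //.
  by rewrite expr0 mul1r ler_nat max_card.
have [c cH] := missed_average Hs C0.
exists (c |: Hs); split; first by rewrite cardsU1; case: (_ \notin _) => //; apply: ltnW.
apply: le_trans cH _; rewrite exprS -mulrA ler_wpM2l //.
by rewrite subr_ge0 ler_pdivrMr ?ltr0n // mul1r ler_nat.
Qed.

(** With more than [N * ln #|V| / q] greedy picks, the bound [(1 - x) ^ m <= exp (- x m)] leaves
    fewer than one missed set, hence none. The summand 2 pays for rounding up and for the default
    value [s]. *)
Lemma hitting_choice (s : V) (N : R) : (0 < q)%N -> #|C|%:R <= N ->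
  exists2 c' : {ffun V -> V}, (forall u, u \in D -> c' u \in U u) &
    #|[set c' u | u in V]%SET|%:R <= N * ln #|V|%:R / q%:R + 2.
Proof.
move=> q0 CN; have V0 : (0 < #|V|)%N by apply/card_gt0P; exists s.
have n1 : 1 <= #|V|%:R :> R by rewrite ler1n.
have lnn : 0 <= ln #|V|%:R :> R by apply: ln_ge0.
have x0 : 0 <= N * ln #|V|%:R / q%:R.
  by rewrite !mulr_ge0 // ?invr_ge0 //; apply: le_trans CN.
have [D0|[u0 u0D]] := finset.set_0Vmem D.
  exists [ffun=> s]; first by move=> u; rewrite D0 inE.
  apply: (@le_trans _ _ #|[set s]%SET|%:R); last by rewrite cards1; lra.
  rewrite ler_nat; apply: subset_leq_card; apply/fintype.subsetP => z.
  by move/finset.imsetP => [u _ ->]; rewrite ffunE inE.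
have qC : (q <= #|C|)%N.
  by apply: leq_trans (Uq u0D) _; apply: subset_leq_card; apply: UC.
have C0 : (0 < #|C|)%N by apply: leq_trans qC.
have [Hs [sH mH]] := hitting_set (Num.truncn (N * ln #|V|%:R / q%:R)).+1 C0 qC.
have m0 : missed Hs = finset.set0.
  apply/eqP; rewrite -cards_eq0 -leqn0 -ltnS -(ltr_nat R).
  apply: le_lt_trans mH _; set m := _.+1.
  have C0R : 0 < #|C|%:R :> R by rewrite ltr0n.
  have q0R : 0 < q%:R :> R by rewrite ltr0n.
  apply: (@le_lt_trans _ _ (expR (- (q%:R / #|C|%:R) * m%:R) * #|V|%:R)).
    rewrite ler_wpM2r // expRM_natr lerXn2r ?nnegrE ?expR_ge0 //.
      by rewrite subr_ge0 ler_pdivrMr // mul1r ler_nat.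
    exact: expR_ge1Dx.
  rewrite mulNr expRN mulrC ltr_pdivrMr ?expR_gt0 // mul1r.
  rewrite -{1}(@lnK _ #|V|%:R) ?posrE ?ltr0n // ltr_expR.
  rewrite mulrAC ltr_pdivlMr // -ltr_pdivrMl // mulrC.
  apply: le_lt_trans (truncnS_gt _); rewrite ler_wpM2r ?invr_ge0 //.
  by rewrite mulrC ler_wpM2r.
exists [ffun u => odflt s [pick c in U u :&: Hs]].
  move=> u uD; rewrite ffunE; case: pickP => [c|no]; first by rewrite inE => /andP[].
  have : u \in missed Hs.
    rewrite inE uD /= -setI_eq0; apply/eqP/finset.setP => c.
    by rewrite (no c) inE.
  by rewrite m0 inE.
apply: (@le_trans _ _ #|s |: Hs|%:R).
  rewrite ler_nat; apply: subset_leq_card; apply/fintype.subsetP => z.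
  move/finset.imsetP => [u _ ->]; rewrite ffunE; case: pickP => [c|no].
    by rewrite !inE => /andP[_ ->]; rewrite orbT.
  by rewrite !inE eqxx.
apply: (@le_trans _ _ ((Num.truncn (N * ln #|V|%:R / q%:R)).+1.+1)%:R).
  by rewrite ler_nat cardsU1; apply: leq_add (leq_b1 _) sH.
rewrite -addn2 natrD lerD2r.
by rewrite truncn_le.
Qed.

End Hitting.

Lemma size_take_leq (T : Type) (N : nat) (l : seq T) : (size (take N l) <= N)%N.
Proof. by rewrite size_take_min geq_minl. Qed.

(** Bounded lists keep the memory a finite type; truncation changes nothing wherever [btakeE]
    applies. *)
Definition btake (T : Type) (N : nat) (l : seq T) : N.-bseq T := Bseq (size_take_leq N l).

Lemma btakeE (T : Type) (N : nat) (l : seq T) : (size l <= N)%N -> btake N l = l :> seq T.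
Proof. exact: take_oversize. Qed.

Lemma set2_inj (V : finType) (x y u v : V) : [set x; y]%SET = [set u; v]%SET ->
  (x = u /\ y = v) \/ (x = v /\ y = u).
Proof.
move=> E.
have : x \in [set u; v]%SET by rewrite -E !inE eqxx.
have : y \in [set u; v]%SET by rewrite -E !inE eqxx orbT.
have : u \in [set x; y]%SET by rewrite E !inE eqxx.
have : v \in [set x; y]%SET by rewrite E !inE eqxx orbT.
rewrite !inE.
by move=> /orP[] /eqP ? /orP[] /eqP ? /orP[] /eqP ? /orP[] /eqP ?; subst; auto.
Qed.

(** * The deterministic spanner phases *)

Section Spanner.
Variables (R : realType) (V : finType) (b : nat) (vl : word b -> R).
Notation eitem := (eitem V b).
Notation wt := (@wt R V b vl).
Notation reach := (@reach R V b vl).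
Implicit Types (F H : seq eitem) (e f : eitem) (ctr : {ffun V -> V}).

Definition other_end (u : V) e : V := odflt u [pick v in ends e :\ u].

Lemma ends_other u e : u \in ends e -> ends e = [set u; other_end u e]%SET.
Proof.
move=> ue; have /cards2P[x [y [xy eE]]] : #|ends e| == 2%N by exact: valP e.
rewrite /other_end; case: pickP => [v|no].
  move: ue; rewrite eE !inE => /orP[] /eqP -> /andP[/negPf vx /orP[] /eqP vE].
  - by move: vx; rewrite vE eqxx.
  - by rewrite vE.
  - by rewrite vE finset.setUC.
  - by move: vx; rewrite vE eqxx.
exfalso; move: ue; rewrite eE !inE => /orP[] /eqP uE; subst u.
  by move: (no y); rewrite eE !inE eqxx orbT eq_sym xy.
by move: (no x); rewrite eE !inE eqxx xy.
Qed.

Lemma ends_set2 e : exists x y, ends e = [set x; y]%SET.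
Proof. have /cards2P[x [y [_ eE]]] : #|ends e| == 2%N by exact: valP e.
by exists x, y. Qed.

Variables (K : R) (q : nat).

Definition spanned H e : Prop :=
  forall x y, ends e = [set x; y]%SET -> reach H x y (K * wt e).

Lemma spanned_sub H H' e : {subset H <= H'} -> spanned H e -> spanned H' e.
Proof. by move=> HH sp x y /sp; apply: reach_sub. Qed.

Lemma spanned1 H e u : u \in ends e -> reach H u (other_end u e) (K * wt e) ->
  spanned H e.
Proof.
move=> ue r x y; rewrite (ends_other ue) => /set2_inj[[<- <-]|[<- <-]] //.
exact: reach_sym.
Qed.

(** A cluster is named by its center, so the class of an edge at [u] is the center of its other end.
    Edges already spanned are discarded. *)
Definition phase_insert H ctr e (L : {ffun V -> q.-bseq eitem}) :
    {ffun V -> q.-bseq eitem} :=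
  if `[< spanned H e >] then L else
  [ffun u => if u \in ends e then
     btake q (insert_lightest (ctr \o other_end u) wt q e (L u)) else L u].

Definition unspanned_at H (u : V) e := ~~ `[< spanned H e >] && (u \in ends e).

Lemma phase_lightest H ctr es u :
  lightest (ctr \o other_end u) wt q [seq e <- es | unspanned_at H u e]
    (foldl (fun L e => phase_insert H ctr e L) [ffun=> btake q [::]] es u).
Proof.
elim/last_ind: es => [|es e]; first by rewrite ffunE /=; apply: lightest_nil.
rewrite foldl_rcons filter_rcons {2}/phase_insert /unspanned_at.
set L := foldl _ _ _; case: asboolP => //= _; rewrite ffunE.
case: ifP => // ue IH; rewrite btakeE; first exact: lightest_insert.
by apply: size_insert_lightest; case: (L u).
Qed.

Variables (es : seq eitem).
Hypothesis w0 : forall e, e \in es -> 0 <= wt e.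

(* The vertices meeting an unspanned edge e after j phases are within j hops of weight
   at most wt e of their centers. *)
Definition near_center j H ctr := forall e, e \in es -> ~ spanned H e ->
  forall u, u \in ends e -> reach H u (ctr u) (j%:R * wt e).

Lemma near_center0 : near_center 0 [::] [ffun u => u].
Proof. by move=> e _ _ u _; rewrite ffunE mul0r; apply: reach_refl. Qed.

Section Phase.
Variables (j : nat) (H H' : seq eitem) (ctr : {ffun V -> V}) (L : V -> seq eitem).
Hypothesis jK : (2 * j + 1)%:R <= K.
Hypothesis near : near_center j H ctr.
Hypothesis HL : forall u,
  lightest (ctr \o other_end u) wt q [seq e <- es | unspanned_at H u e] (L u).
Hypothesis HH' : {subset H <= H'}.
Hypothesis LH' : forall u, {subset L u <= H'}.

Lemma phase_item u f : f \in L u -> [/\ f \in es, ~ spanned H f & u \in ends f].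
Proof.
case: (HL u) => sub _ _ _ /sub; rewrite mem_filter => /andP[/andP[]].
by move/asboolPn.
Qed.

(** Otherwise the list at [u] holds some [f], no heavier than [e], to the same cluster. Going along
    [f], then to the common center and back out to the other end of [e] costs at most
    [(2 * j + 1) * wt e], so [e] would be spanned. *)
Lemma phase_full e u : e \in es -> ~ spanned H' e -> u \in ends e ->
  size (L u) = q /\ forall f, f \in L u -> wt f <= wt e.
Proof.
move=> ees nsp ue; have nspH : ~ spanned H e by move=> /(spanned_sub HH').
have ve : other_end u e \in ends e by rewrite (ends_other ue) !inE eqxx orbT.
case: (HL u) => sub _ _ /(_ e).
rewrite mem_filter ees /unspanned_at ue andbT; case: asboolP => //= _.
case=> // -[f fL [/= fe wfe]]; exfalso; apply: nsp; apply: (spanned1 ue).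
have [fes nspf uf] := phase_item fL.
have vf : other_end u f \in ends f by rewrite (ends_other uf) !inE eqxx orbT.
have r1 : reach H' u (other_end u f) (wt f) by apply: reach1 (ends_other uf); apply: LH' fL.
have r2 := reach_sub HH' (near fes nspf vf).
have r3 := reach_sym (reach_sub HH' (near ees nspH ve)).
rewrite fe in r2; have := reach_trans r1 (reach_trans r2 r3).
move=> /reach_le; apply; apply: (@le_trans _ _ ((2 * j + 1)%:R * wt e)); last first.
  by rewrite ler_wpM2r // w0.
have : j%:R * wt f <= j%:R * wt e by rewrite ler_wpM2l.
by rewrite natrD natrM; lra.
Qed.

(** An end of an unspanned edge [e] has a full list of edges no heavier than [e]. Its new center is
    reached by one of them followed by the old path, which adds one hop. *)
Lemma phase_near ctr' :
  (forall u, size (L u) = q -> exists2 f, f \in L u & ctr' u = ctr (other_end u f)) ->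
  near_center j.+1 H' ctr'.
Proof.
move=> hit e ees nsp u ue; have [sq le] := phase_full ees nsp ue.
have [f fL ->] := hit u sq; have [fes nspf uf] := phase_item fL.
have vf : other_end u f \in ends f by rewrite (ends_other uf) !inE eqxx orbT.
have r1 : reach H' u (other_end u f) (wt f) by apply: reach1 (ends_other uf); apply: LH' fL.
have r2 := reach_sub HH' (near fes nspf vf).
apply: reach_le (reach_trans r1 r2) _.
have : j%:R * wt f <= j%:R * wt e by rewrite ler_wpM2l // le.
by rewrite -natr1 mulrDl mul1r; have := le f fL; lra.
Qed.

(** A full list at a vertex shows [q] distinct clusters; when fewer remain, no edge can stay
    unspanned. *)
Lemma phase_last : (#|[set ctr u | u in V]%SET| < q)%N ->
  forall e, e \in es -> spanned H' e.
Proof.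
move=> im e ees; apply: contrapT => nsp; have [x [y eE]] := ends_set2 e.
have ue : x \in ends e by rewrite eE !inE eqxx.
have [sq _] := phase_full ees nsp ue.
move: im; rewrite ltnNge => /negP; apply; rewrite -sq -(size_map (ctr \o other_end x)).
case: (HL x) => _ uL _ _; rewrite -(card_uniqP uL); apply: subset_leq_card.
by apply/fintype.subsetP => z /mapP[f _ ->]; apply/finset.imsetP; exists (other_end x f).
Qed.

Lemma phase_centers (s : V) (N : R) : (0 < q)%N ->
  #|[set ctr u | u in V]%SET|%:R <= N ->
  exists ctr' : {ffun V -> V},
   (forall u, size (L u) = q -> exists2 f, f \in L u & ctr' u = ctr (other_end u f)) /\
   #|[set ctr' u | u in V]%SET|%:R <= N * ln #|V|%:R / q%:R + 2.
Proof.
move=> q0 imN.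
pose D := [set u | size (L u) == q]%SET.
pose U u := [set z in map (ctr \o other_end u) (L u)]%SET.
have UC u : u \in D -> U u \subset [set ctr u | u in V]%SET.
  move=> _; apply/fintype.subsetP => z; rewrite inE => /mapP[f _ ->].
  by apply/finset.imsetP; exists (other_end u f).
have Uq u : u \in D -> (q <= #|U u|)%N.
  rewrite inE => /eqP sq; case: (HL u) => _ uL _ _.
  by rewrite cardsE (card_uniqP uL) size_map sq.
have [c' c'U c'N] := hitting_choice UC Uq s q0 imN.
exists c'; split=> // u sq; have /c'U : u \in D by rewrite inE sq.
by rewrite inE => /mapP[f fL ->]; exists f.
Qed.

End Phase.
End Spanner.

(** * Expectations of finite distributions *)

Section Expectation.
Variables (R : realType) (T U : finType).

Definition expect (p : fdist R T) (f : T -> R) : R := \sum_x p x * f x.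

Lemma expect_dirac (a : T) f : expect (fdirac R a) f = f a.
Proof.
rewrite /expect (bigD1 a) //= eqxx mul1r big1 ?addr0 // => x /negPf ->.
by rewrite mul0r.
Qed.

Lemma Pr_expect (p : fdist R T) (A : T -> Prop) :
  Pr p A = expect p (fun x => (`[< A x >])%:R).
Proof.
rewrite /Pr /expect big_mkcond; apply: eq_bigr => x _.
by case: ifP => _; rewrite ?mulr1 ?mulr0.
Qed.

End Expectation.

Lemma expect_bind (R : realType) (T U : finType) (p : fdist R T) (k : T -> fdist R U) f :
  expect (fbind p k) f = expect p (fun x => expect (k x) f).
Proof.
rewrite /expect /=; under eq_bigr do rewrite mulr_suml.
rewrite exchange_big; apply: eq_bigr => x _; rewrite mulr_sumr.
by apply: eq_bigr => y _; rewrite mulrA.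
Qed.

Section Coin.
Variables (R : realType) (p : R).
Hypothesis p01 : 0 <= p <= 1.

Lemma coin_ge0 (c : bool) : 0 <= (if c then p else 1 - p).
Proof. by case/andP: p01 => ? ?; case: c; rewrite ?subr_ge0. Qed.

Lemma coin_sum1 : \sum_(c : bool) (if c then p else 1 - p) = 1.
Proof. by rewrite big_bool /= addrC subrK. Qed.

Definition coin : fdist R bool := FDist coin_ge0 coin_sum1.

End Coin.

(** * Machines with a finite state, and their simulation in the streaming model *)

Section Machine.
Variables (R : realType) (V : finType) (b : nat) (X : finType).
Notation eitem := (eitem V b).
Variables (p : nat -> eitem -> X -> R) (upd : nat -> eitem -> X -> X).
Variable (fin : nat -> X -> X).
Hypothesis p01 : forall i e x, 0 <= p i e x <= 1.

(* wp i es f x: the expectation of f after pass number i, entered in state x. *)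
Fixpoint wp (i : nat) (es : seq eitem) (f : X -> R) (x : X) : R :=
  if es is e :: es' then
    p i e x * wp i es' f (upd i e x) + (1 - p i e x) * wp i es' f x
  else f (fin i x).

Lemma wp_cons i e es f x : wp i (e :: es) f x =
  p i e x * wp i es f (upd i e x) + (1 - p i e x) * wp i es f x.
Proof. by []. Qed.

Fixpoint wpr (es : seq eitem) (i m : nat) (f : X -> R) (x : X) : R :=
  if m is m'.+1 then wp i es (wpr es i.+1 m' f) x else f x.

(** Counting suffices, since any injection of the pairs of a pass number and a state into the memory
    serves as encoding. The pass number is part of the memory because transitions depend on it; it
    takes [passes.+1] values, the last one after the final pass. *)
Lemma simulation (space passes : nat) (x0 : X) (out : X -> graph_on V) :
  (passes.+1 * #|X| <= 2 ^ (b * space))%N ->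
  exists A : stream_alg R V b,
   [/\ sa_space A = space, sa_passes A = passes &
   forall (es : seq eitem) (Phi : graph_on V -> Prop),
     Pr (run A (map val es)) (fun m => Phi (sa_output m)) =
     wpr es 0 passes (fun x => (`[< Phi (out x) >])%:R) x0].
Proof.
move=> card_le; pose Y : finType := ('I_passes.+1 * X)%type.
pose mem : finType := (space.-tuple (word b)).
have cY : (#|Y| <= #|mem|)%N.
  by rewrite card_prod card_ord !card_tuple card_bool -expnM.
pose enc (y : Y) : mem := enum_val (widen_ord cY (enum_rank y)).
have enc_inj : injective enc.
  move=> y y' /enum_val_inj /(congr1 val) /= E.
  by apply: enum_rank_inj; apply: val_inj.
pose y0 : Y := (ord0, x0).
pose dec (m : mem) : Y := odflt y0 [pick y | enc y == m].
have encK : cancel enc dec.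
  move=> y; rewrite /dec; case: pickP => [z /eqP /enc_inj //|/(_ y)].
  by rewrite eqxx.
pose next (y : Y) (x : X) : Y := (inord y.1.+1, x).
pose step (i : item V b) (m : mem) : fdist R mem :=
  if insub i is Some e then
    let y := dec m in
    fbind (coin (p01 y.1 e y.2))
      (fun c => fdirac R (enc (y.1, if c then upd y.1 e y.2 else y.2)))
  else fdirac R m.
pose stop (m : mem) : fdist R mem :=
  let y := dec m in fdirac R (enc (next y (fin y.1 y.2))).
pose A := StreamAlg passes (enc y0) step stop (fun m => out (dec m).2).
exists A; split=> // es Phi; rewrite Pr_expect.
have passE (mu : fdist R mem) (g : Y -> R) :
    expect (@run_pass _ _ _ A (map val es) mu) (g \o dec) =
    expect mu ((fun y : Y => wp y.1 es (g \o next y) y.2) \o dec).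
  rewrite /run_pass expect_bind.
  have -> : (fun m : mem => expect (@sa_end_pass _ _ _ A m) (g \o dec)) =
      (fun y : Y => g (next y (fin y.1 y.2))) \o dec.
    by apply/funext => m; rewrite /= expect_dirac /= encK.
  elim: es mu => [//|e es IH] mu; rewrite [foldl _ _ _]/= IH expect_bind.
  congr (expect mu); apply/funext => m; rewrite /= /step valK /= expect_bind.
  by rewrite /expect big_bool -!/(expect _ _) /= !expect_dirac /= !encK.
(* The counterpart of [wpr] that reads the pass number off the state; [FE] identifies the two while
   that number stays in range. *)
pose F := fix F m (g : Y -> R) (y : Y) : R :=
  if m is m'.+1 then wp y.1 es (F m' g \o next y) y.2 else g y.
have runE m (mu : fdist R mem) (g : Y -> R) :
    expect (iter m (@run_pass _ _ _ A (map val es)) mu) (g \o dec) =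
    expect mu (F m g \o dec).
  by elim: m mu => [//|m IH] mu; rewrite iterSr IH passE.
rewrite /run; pose h (x : X) : R := (`[< Phi (out x) >])%:R.
rewrite -/h (_ : (fun _ => _) = (h \o snd) \o dec) // runE expect_dirac /= encK.
have FE m i x : (i + m <= passes)%N ->
    F m (h \o snd) (inord i, x) = wpr es i m h x.
  elim: m i x => [//|m IH] i x im /=.
  have iE : (inord i : 'I_passes.+1) = i :> nat.
    by rewrite inordK // ltnS; apply: leq_trans im; apply: leq_addr.
  rewrite iE; congr (wp i es _ x); apply/funext => x'.
  by rewrite /= /next /= iE IH // addSnnS.
rewrite -(FE passes 0%N x0) ?add0n //; congr (F _ _ (_, _)).
by apply: val_inj; rewrite /= inordK.
Qed.

Lemma wp_le i es f g x : (forall x, f x <= g x) -> wp i es f x <= wp i es g x.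
Proof.
move=> fg; elim: es x => [|e es IH] x /=; first exact: fg.
by have /andP[p0 p1] := p01 i e x; rewrite lerD // ler_wpM2l // subr_ge0.
Qed.

Lemma wpD i es f g x :
  wp i es (fun x => f x + g x) x = wp i es f x + wp i es g x.
Proof.
by elim: es x => [//|e es IH] x /=; rewrite !IH !mulrDr addrACA.
Qed.

Lemma wp_cst i es (a : R) x : wp i es (fun=> a) x = a.
Proof. by elim: es x => [//|e es IH] x /=; rewrite !IH -mulrDl addrC subrK mul1r. Qed.

Lemma wpr_le1 es i m f x : (forall y, f y <= 1) -> wpr es i m f x <= 1.
Proof.
move=> f1; elim: m i x => [|m IH] i x /=; first exact: f1.
by apply: le_trans (wp_le _ _ _ (fun y => IH i.+1 y)) _; rewrite wp_cst.
Qed.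

Lemma wpr_le es i m f g x : (forall y, f y <= g y) ->
  wpr es i m f x <= wpr es i m g x.
Proof.
by move=> fg; elim: m i x => [|m IH] i x /=; [apply: fg|apply: wp_le].
Qed.

Lemma wpr_invariant es (inv : nat -> X -> Prop) (delta : nat -> R) i m x :
  (forall j x, (i <= j < i + m)%N -> inv j x ->
     wp j es (fun y => (~~ `[< inv j.+1 y >])%:R) x <= delta j) ->
  (forall j, 0 <= delta j) -> inv i x ->
  wpr es i m (fun y => (~~ `[< inv (i + m)%N y >])%:R) x <=
    \sum_(i <= j < i + m) delta j.
Proof.
move=> step d0; elim: m i x step => [|m IH] i x step invx.
  by rewrite addn0 big_geq //= asboolT.
rewrite /= big_ltn ?addnS ?ltnS ?leq_addr // -addSn.
have stepS j y : (i.+1 <= j < i.+1 + m)%N -> inv j y ->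
    wp j es (fun y => (~~ `[< inv j.+1 y >])%:R) y <= delta j.
  by move=> /andP[ij jm]; apply: step; rewrite ltnW //= addnS -addSn.
set rest := \sum_(_ <= _ < _) _.
have rest0 : 0 <= rest by apply: sumr_ge0.
apply: (@le_trans _ _ (wp i es (fun y => (~~ `[< inv i.+1 y >])%:R + rest) x)).
  apply: wp_le => y; case: asboolP => yi /=; first by rewrite add0r; apply: IH.
  apply: le_trans (wpr_le1 _ _ _ _ _) _; first by move=> z; case: (~~ _); rewrite ?ler01.
  by rewrite lerDl.
rewrite wpD wp_cst lerD2r; apply: step => //.
by rewrite leqnn addnS ltnS leq_addr.
Qed.

Lemma wpr_compl es i m (Q : X -> bool) x :
  wpr es i m (fun y => (Q y)%:R) x = 1 - wpr es i m (fun y => (~~ Q y)%:R) x.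
Proof.
apply/eqP; rewrite eq_sym subr_eq; apply/eqP.
elim: m i x => [|m IH] i x /=; first by case: (Q x); rewrite ?addr0 ?add0r.
rewrite -wpD -[LHS](wp_cst i es 1 x); congr (wp i es _ x).
by apply/funext => y; apply: IH.
Qed.

Lemma wp_det i es f x : (forall e x, p i e x = 1) ->
  wp i es f x = f (fin i (foldl (fun x e => upd i e x) x es)).
Proof.
by move=> p1; elim: es x => [//|e es IH] x /=; rewrite p1 subrr mul0r addr0 mul1r.
Qed.

End Machine.

(** * Independent sampling into a list of bounded length *)

Section Sampling.
Variables (R : realType) (I : eqType) (cap : nat) (rho : I -> R).
Hypothesis rho0 : forall e, 0 <= rho e.
Implicit Types (es : seq I) (S : cap.-bseq I) (g : cap.-bseq I -> R).

(* Every item e of es enters the sample independently with probability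
   1 - exp (- rho e). *)
Fixpoint sample es g S : R :=
  if es is e :: es' then
    (1 - expR (- rho e)) * sample es' g (btake cap (e :: S)) +
    expR (- rho e) * sample es' g S
  else g S.

Lemma keep_ge0 e : 0 <= 1 - expR (- rho e).
Proof. by rewrite subr_ge0 -expR0 ler_expR oppr_le0. Qed.

Lemma keep_le e : 1 - expR (- rho e) <= rho e.
Proof. by have := expR_ge1Dx (- rho e); lra. Qed.

Lemma sample_le es g g' S :
  (forall S', {subset S' <= S ++ es} -> g S' <= g' S') ->
  sample es g S <= sample es g' S.
Proof.
elim: es S => [|e es IH] S gg /=; first by apply: gg => z; rewrite cats0.
apply: lerD; apply: ler_wpM2l; rewrite ?expR_ge0 ?keep_ge0 //; apply: IH => S' sub.
  apply: gg => z /sub; rewrite !mem_cat [z \in e :: es]inE => /orP[/mem_take|->].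
    by rewrite inE => /orP[->|->]; rewrite ?orbT.
  by rewrite !orbT.
by apply: gg => z /sub; rewrite !mem_cat inE => /orP[->|->]; rewrite ?orbT.
Qed.

Lemma sampleD es g g' S :
  sample es (fun S => g S + g' S) S = sample es g S + sample es g' S.
Proof. by elim: es S => [//|e es IH] S /=; rewrite !IH !mulrDr addrACA. Qed.

Lemma sample_sum (T : Type) (r : seq T) (P : pred T) es (G : T -> cap.-bseq I -> R) S :
  sample es (fun S => \sum_(t <- r | P t) G t S) S = \sum_(t <- r | P t) sample es (G t) S.
Proof.
elim: es S => [//|e es IH] S /=.
by rewrite !IH !mulr_sumr -big_split.
Qed.

(* Each item multiplies the expectation of 2 ^ size S by at most 1 + rho e. *)
Lemma sample_full es S : sample es (fun S => (size S == cap)%:R) S <=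
  expR (\sum_(e <- es) rho e) * 2 ^+ size S / 2 ^+ cap.
Proof.
have p2 : 0 < 2 ^+ cap :> R by rewrite exprn_gt0.
apply: (@le_trans _ _ (sample es (fun S => 2 ^+ size S / 2 ^+ cap) S)).
  apply: sample_le => S' _; case: eqP => [->|_] /=; first by rewrite divff ?gt_eqF.
  by rewrite mulr_ge0 ?invr_ge0 ?exprn_ge0 // ltW.
elim: es S => [|e es IH] S /=; first by rewrite big_nil expR0 mul1r.
rewrite big_cons expRD.
set q := expR (\sum_(_ <- _) _) in IH *; set v := 2 ^+ size S / 2 ^+ cap : R.
have v0 : 0 <= v by rewrite mulr_ge0 ?invr_ge0 ?exprn_ge0 // ltW.
have q0 : 0 <= q by apply: expR_ge0.
have le1 : sample es (fun S => 2 ^+ size S / 2 ^+ cap) (btake cap (e :: S)) <= q * (2 * v).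
  apply: le_trans (IH _) _; rewrite -mulrA ler_wpM2l // /v mulrA -exprS.
  apply: ler_wpM2r; first by rewrite invr_ge0 ltW.
  by apply: ler_weXn2l; rewrite ?ler1n // size_take_min geq_minr.
have le2 : sample es (fun S => 2 ^+ size S / 2 ^+ cap) S <= q * v by rewrite mulrA.
apply: le_trans (lerD (ler_wpM2l (keep_ge0 e) le1) (ler_wpM2l (expR_ge0 _) le2)) _.
have -> : (1 - expR (- rho e)) * (q * (2 * v)) + expR (- rho e) * (q * v) =
   (1 + (1 - expR (- rho e))) * (q * v) by lra.
apply: (@le_trans _ _ (expR (rho e) * (q * v))); last by rewrite /v !mulrA.
rewrite ler_wpM2r ?mulr_ge0 //.
by apply: le_trans (expR_ge1Dx _); rewrite lerD2l keep_le.
Qed.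

(** Every item of [A] must be rejected, which multiplies the factors [exp (- rho e)]. Full samples
    are excluded because truncation could make them lose an item of [A]. *)
Lemma sample_miss es (A : pred I) S :
  sample es (fun S => ((size S < cap)%N && ~~ has A S)%:R) S <=
  expR (- \sum_(e <- es | A e) rho e) * ((size S < cap)%N && ~~ has A S)%:R.
Proof.
elim: es S => [|e es IH] S /=; first by rewrite big_nil oppr0 expR0 mul1r.
have Ecap : (size S < cap)%N = false -> (size (btake cap (e :: S)) < cap)%N = false.
  move=> sf; apply/negbTE; rewrite -leqNgt size_take_min /= leq_min leqnn /=.
  by apply: leqW; rewrite leqNgt sf.
pose g (S : cap.-bseq I) : R := ((size S < cap)%N && ~~ has A S)%:R.
have {}IH S' : sample es g S' <= expR (- \sum_(e <- es | A e) rho e) * g S' := IH S'.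
rewrite -/g -/(g S); have g0 S' : 0 <= g S' by apply: ler0n.
rewrite big_cons; case: ifP => Ae.
  have gz : g (btake cap (e :: S)) = 0.
    rewrite /g; case: (ltnP (size S) cap) => [lt|ge].
      by rewrite btakeE //= Ae andbF.
    by rewrite Ecap // ltnNge ge.
  have := IH (btake cap (e :: S)); rewrite gz mulr0 => le0.
  rewrite opprD expRD -mulrA; apply: le_trans (lerD _ (ler_wpM2l (expR_ge0 _) (IH S))) _.
    exact: (ler_wpM2l (keep_ge0 e) le0).
  by rewrite mulr0 add0r.
have gle : g (btake cap (e :: S)) <= g S.
  rewrite /g; case: (ltnP (size S) cap) => [lt|ge].
    by rewrite btakeE //= Ae ler_nat /=; case: (size S).+1 => [|m]; case: (_ < _)%N.
  by rewrite Ecap // ltnNge ge.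
apply: le_trans (lerD (ler_wpM2l (keep_ge0 e) (IH _)) (ler_wpM2l (expR_ge0 _) (IH S))) _.
set q := expR (- \sum_(_ <- _ | _) _).
have le1 : q * g (btake cap (e :: S)) <= q * g S by rewrite ler_wpM2l // expR_ge0.
have := ler_wpM2l (keep_ge0 e) le1; lra.
Qed.

(** A union bound over overflow and over all heavy [t]. As it covers every [t] at once, it also
    applies to a [t] that is chosen after seeing the sample. *)
Lemma sample_net es (T : finType) (A : T -> pred I) (heavy : pred T) (lambda : R) :
  (forall t, heavy t -> lambda <= \sum_(e <- es | A t e) rho e) ->
  sample es (fun S => ((size S == cap) ||
     [exists t, heavy t && ~~ has (A t) S])%:R) (btake cap [::]) <=
  expR (\sum_(e <- es) rho e) / 2 ^+ cap + #|T|%:R * expR (- lambda).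
Proof.
move=> hv.
apply: (@le_trans _ _ (sample es (fun S => (size S == cap)%:R + \sum_(t | heavy t)
    ((size S < cap)%N && ~~ has (A t) S)%:R) (btake cap [::]))).
  apply: sample_le => S _; have [sS|sS] := eqVneq (size S) cap.
    by rewrite /= lerDl sumr_ge0.
  rewrite /= add0r; case: existsP => [[t /andP[ht nt]]|_]; last by rewrite sumr_ge0.
  rewrite (bigD1 t) //= nt andbT ltn_neqAle sS /=.
  by case: (S) => l /= ->; rewrite lerDl sumr_ge0.
rewrite sampleD sample_sum; apply: lerD.
  by apply: le_trans (sample_full _ _) _; rewrite /= expr0 mulr1.
apply: (@le_trans _ _ (\sum_(t | heavy t) expR (- lambda))).
  apply: ler_sum => t ht; apply: le_trans (sample_miss _ _ _) _.
  apply: (@le_trans _ _ (expR (- \sum_(e <- es | A t e) rho e))).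
    by rewrite ler_piMr ?expR_ge0 //; case: (_ && _); rewrite ?ler01.
  by rewrite ler_expR lerN2 hv.
rewrite sumr_const -[X in X <= _]mulr_natl ler_wpM2r ?expR_ge0 // ler_nat.
exact: max_card.
Qed.

End Sampling.

(** * Violated edges, and averaging over the stored trees *)

Section Reweighting.
Variables (R : realType) (V : finType) (b : nat) (vl : word b -> R) (s : V).
Notation eitem := (eitem V b).
Notation wt := (@wt R V b vl).
Notation reach := (@reach R V b vl).
Notation tree := (#|V|.-bseq eitem).
Implicit Types (F H es : seq eitem) (e : eitem) (T : tree) (Ts : seq tree).

Definition violated T e : bool := ~~ `[< forall x y l, ends e = [set x; y]%SET ->
  reach T s x l -> reach T s y (l + wt e) >].

Definition nviol Ts e : nat := count (fun T => violated T e) Ts.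

Definition stretch_le (K : R) T e : Prop := forall x y l, ends e = [set x; y]%SET ->
  reach T s x l -> reach T s y (l + K * wt e).

(** Only size and distances from [s] are recorded for intermediate trees; being a tree is demanded
    of the output in [output_spec]. *)
Definition sptree F : tree := xget (btake _ [::])
  [set T : tree | {subset T <= F} /\ forall v l, reach F s v l -> reach T s v l]%classic.

Lemma sptreeP F : (forall e, e \in F -> 0 <= wt e) ->
  {subset sptree F <= F} /\ forall v l, reach F s v l -> reach (sptree F) s v l.
Proof.
move=> F0; have [T [X [TF sT _ _ TR]]] := spt_exists s F0.
have E : btake #|V| T = T :> seq _ := btakeE sT.
apply: (xgetPex (btake _ [::]) (P := fun T : tree =>
  {subset T <= F} /\ forall v l, reach F s v l -> reach T s v l)).
exists (btake #|V| T); split=> [z|v l /TR]; last by rewrite E.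
by change (z \in (btake #|V| T : seq eitem) -> z \in F); rewrite E; apply: TF.
Qed.

Lemma sptree_not_violated F e : (forall e, e \in F -> 0 <= wt e) ->
  e \in F -> ~~ violated (sptree F) e.
Proof.
move=> F0 eF; have [sub pres] := sptreeP F0; rewrite negbK; apply/asboolP.
move=> x y l eE r; apply: pres; apply: reach_trans (reach_sub sub r) _.
exact: reach1 eE.
Qed.

Lemma sptree_stretch F H K e : (forall e, e \in F -> 0 <= wt e) ->
  {subset H <= F} -> spanned vl K H e -> stretch_le K (sptree F) e.
Proof.
move=> F0 HF sp x y l eE r; have [sub pres] := sptreeP F0.
by apply: pres; apply: reach_trans (reach_sub sub r) (reach_sub HF (sp _ _ eE)).
Qed.

(** Follow the walk edge by edge: a violated edge costs at most [K] times its weight, any other edge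
    just its weight. The list [p] is fixed before [T], so the same edges can be summed over all
    trees. *)
Lemma walk_bound es K x t L : reach es x t L ->
  (forall e, e \in es -> 0 <= wt e) ->
  exists p, [/\ {subset p <= es}, \sum_(e <- p) wt e <= L &
    forall T l, (forall e, e \in es -> stretch_le K T e) -> reach T s x l ->
      reach T s t (l + \sum_(e <- p) (1 + (K - 1) * (violated T e)%:R) * wt e)].
Proof.
move=> r es0; elim: r => [z l l0|e u v z l1 l2 ees eE _ [p [pes pL pT]] le1].
  by exists [::]; split=> // [|T m _]; rewrite big_nil ?addr0.
exists (e :: p); split.
- by move=> a; rewrite inE => /predU1P[->|/pes].
- by rewrite big_cons; apply: le_trans le1; rewrite lerD2l.
move=> T m lip ru; rewrite big_cons addrA; apply: pT => //.
rewrite /violated; case: asboolP => [nv|_] /=.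
  by rewrite mulr0 addr0 mul1r; apply: nv ru.
by rewrite mulr1 (addrC 1) subrK; apply: lip ru.
Qed.

(** Suppose that every tree fails and add up the bounds of [walk_bound]. Each edge is surcharged
    [K - 1] times its weight in at most [J] trees, so the total is at most [(size Ts + (K - 1) * J)
    * W <= size Ts * (1 + eps) * W], a contradiction. *)
Lemma some_tree_good es K eps (J : nat) Ts t L :
  (forall e, e \in es -> 0 <= wt e) -> 1 <= K -> 0 <= eps -> (0 < size Ts)%N ->
  (K - 1) * J%:R <= (size Ts)%:R * eps ->
  (forall T, T \in Ts -> forall e, e \in es -> stretch_le K T e) ->
  (forall e, e \in es -> (nviol Ts e <= J)%N) ->
  reach es s t L -> exists2 T, T \in Ts & reach T s t ((1 + eps) * L).
Proof.
move=> es0 K1 e0 sz KJ lip nv r.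
have [p [pes pL pT]] := walk_bound K r es0.
have p0 e : e \in p -> 0 <= wt e by move/pes/es0.
apply: contrapT => none; set W := \sum_(e <- p) wt e in pL *.
have W0 : 0 <= W by rewrite /W big_seq sumr_ge0.
have lt T : T \in Ts ->
    (1 + eps) * L < W + (K - 1) * \sum_(e <- p) (violated T e)%:R * wt e.
  move=> TTs; rewrite ltNge; apply/negP => le; apply: none; exists T => //.
  apply: reach_le (pT T 0 (lip T TTs) (reach_refl _ _ _ (lexx 0))) _.
  rewrite add0r; apply: le_trans le; rewrite /W mulr_sumr -big_split /=.
  by rewrite le_eqVlt; apply/orP; left; apply/eqP/eq_bigr => e _; rewrite mulrDl mul1r mulrA.
have : \sum_(T <- Ts) (1 + eps) * L <
    \sum_(T <- Ts) (W + (K - 1) * \sum_(e <- p) (violated T e)%:R * wt e).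
  rewrite big_seq [ltRHS]big_seq; apply: ltr_sum => //.
  by case: (Ts) sz => [//|T Ts' _]; rewrite /= inE eqxx.
rewrite big_split /= -[X in _ < _ + X]mulr_sumr !big_const_seq !count_predT !iter_addr_0.
rewrite exchange_big /=.
have -> : \sum_(e <- p) \sum_(T <- Ts) (violated T e)%:R * wt e =
    \sum_(e <- p) (nviol Ts e)%:R * wt e.
  apply: eq_bigr => e _; rewrite -mulr_suml; congr (_ * _).
  rewrite /nviol -sum1_count natr_sum [RHS]big_mkcond.
  by apply: eq_bigr => T _; case: violated.
have leJ : \sum_(e <- p) (nviol Ts e)%:R * wt e <= J%:R * W.
  rewrite /W mulr_sumr big_seq [leRHS]big_seq; apply: ler_sum => e ep.
  by rewrite ler_wpM2r ?p0 // ler_nat nv // pes.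
apply/negP; rewrite -leNgt -[leRHS]mulr_natl -[W *+ _]mulr_natl.
have K0 : 0 <= K - 1 by rewrite subr_ge0.
apply: le_trans (lerD (lexx _) (ler_wpM2l K0 leJ)) _.
rewrite mulrA; apply: le_trans (lerD (lexx _) (ler_wpM2r W0 KJ)) _.
rewrite -mulrA -mulrDr ler_wpM2l // -{1}[W]mul1r -mulrDl ler_wpM2l //.
by rewrite addr_ge0.
Qed.

Variable M : R.
Hypothesis M1 : 1 <= M.

Definition importance Ts e : R := M ^+ nviol Ts e.

Lemma importance_ge0 Ts e : 0 <= importance Ts e.
Proof. by rewrite exprn_ge0 // (le_trans ler01). Qed.

Lemma importance_rcons es Ts T :
  \sum_(e <- es) importance (rcons Ts T) e <=
  \sum_(e <- es) importance Ts e + M * \sum_(e <- es | violated T e) importance Ts e.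
Proof.
rewrite mulr_sumr [X in _ + X]big_mkcond -big_split /=; apply: ler_sum => e _.
rewrite /importance /nviol -cats1 count_cat /= addn0 exprD.
case: violated; last by rewrite mulr1 addr0.
by rewrite expr1 mulrC lerDr importance_ge0.
Qed.

End Reweighting.

(** * The algorithm as a finite machine, with its pass invariants *)

Section Algorithm.
Variables (R : realType) (V : finType) (b : nat) (vl : word b -> R) (s : V).
Variables (K M tau gamma N0 : R) (k q NH cap r : nat).
Notation eitem := (eitem V b).
Notation wt := (@wt R V b vl).
Notation reach := (@reach R V b vl).
Notation tree := (#|V|.-bseq eitem).
Notation violated := (@violated R V b vl s).
Notation importance := (@importance R V b vl s M).
Implicit Types (e : eitem).

(** Centers, spanner, lists of the current phase, stored trees. Importances are not stored: they are
    recomputed from the trees. *)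
Definition config : finType :=
  ({ffun V -> V} * NH.-bseq eitem * {ffun V -> q.-bseq eitem} * r.-bseq tree)%type.

Definition state : finType := (config * cap.-bseq eitem)%type.

Definition mass_bound (j : nat) : R := N0 * (1 + gamma) ^+ j.

(** Dividing by the a priori bound instead of the true total importance makes the rate computable
    from the stored trees alone. While that bound is valid, the rates add up to at most [tau]. *)
Definition rate (Ts : seq tree) e : R :=
  tau * importance Ts e / mass_bound (size Ts).

(* Passes i < k build a spanner; the later ones are importance sampling rounds. *)
Definition prob (i : nat) e (x : state) : R :=
  if (i < k)%N then 1 else 1 - expR (- rate x.1.2 e).

Definition update (i : nat) e (x : state) : state :=
  let: (ctr, H, L, Ts, smp) := x in
  if (i < k)%N then (ctr, H, phase_insert vl K H ctr e L, Ts, smp)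
  else (ctr, H, L, Ts, btake cap (e :: smp)).

Definition good_centers (i : nat) (ctr : {ffun V -> V}) (L : V -> seq eitem)
    (ctr' : {ffun V -> V}) : Prop :=
  (forall u, size (L u) = q -> exists2 f, f \in L u & ctr' u = ctr (other_end u f)) /\
  #|[set ctr' u | u in V]%SET|%:R <= 4 * M ^+ (k - i.+1).

Definition all_items (L : {ffun V -> q.-bseq eitem}) : seq eitem :=
  flatten [seq (L u : seq eitem) | u <- enum V].

Definition finish (i : nat) (x : state) : state :=
  let: (ctr, H, L, Ts, smp) := x in
  if (i < k)%N then
    (xget ctr (good_centers i ctr (fun u => (L : {ffun V -> q.-bseq eitem}) u)), btake NH (H ++ all_items L),
     [ffun=> btake q [::]], Ts, smp)
  else (ctr, H, L, btake r (rcons Ts (sptree vl s (smp ++ H))), btake cap [::]).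

Definition init : state :=
  ([ffun u => u], btake NH [::], [ffun=> btake q [::]], btake r [::], btake cap [::]).

Definition output_spec (Ts : seq tree) (G : {set V} * {set {set V}}) : Prop :=
  exists T : seq eitem,
    [/\ {subset T <= flatten (map val Ts)}, G.2 = [set ends e | e in T]%SET,
        is_tree G, s \in G.1 &
        forall v l, reach (flatten (map val Ts)) s v l -> reach T s v l].

Definition output (x : state) : graph_on V :=
  xget (finset.set0, finset.set0) (output_spec x.1.2).

Hypothesis tau0 : 0 <= tau.
Hypothesis M1 : 1 < M.
Hypothesis gamma0 : 0 <= gamma.
Hypothesis N0_gt0 : 0 < N0.

Lemma mass_bound_gt0 j : 0 < mass_bound j.
Proof. by rewrite mulr_gt0 // exprn_gt0 // ltr_pwDl. Qed.

Lemma rate_ge0 Ts e : 0 <= rate Ts e.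
Proof.
by rewrite mulr_ge0 ?invr_ge0 ?(ltW (mass_bound_gt0 _)) // mulr_ge0 // importance_ge0 // ltW.
Qed.

Lemma prob_01 i e x : 0 <= prob i e x <= 1.
Proof.
rewrite /prob; case: ifP => _; first by rewrite ler01 lexx.
apply/andP; split; first exact: (keep_ge0 (rate_ge0 _)).
by have := expR_ge0 (- rate x.1.2 e); lra.
Qed.

Variable es : seq eitem.
Hypothesis es0 : forall e, e \in es -> 0 <= wt e.
Hypothesis es_size : (size es)%:R <= N0.

Notation wp := (wp prob update finish).

Definition spanner_inv (j : nat) (x : state) : Prop :=
  let: (ctr, H, L, Ts, smp) := x in
  [/\ (size H <= j * (#|V| * q))%N, {subset H <= es},
      [/\ L = [ffun=> btake q [::]], Ts = btake r [::] & smp = btake cap [::]],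
      near_center vl K es j H ctr &
      #|[set ctr u | u in V]%SET|%:R <= 4 * M ^+ (k - j)].

Definition sampling_inv (j : nat) (x : state) : Prop :=
  let: (ctr, H, L, Ts, smp) := x in
  [/\ {subset H <= es}, forall e, e \in es -> spanned vl K H e,
      size Ts = j /\ smp = btake cap [::],
      forall T, T \in (Ts : seq tree) -> {subset T <= es} /\
        (forall e, e \in es -> stretch_le vl s K T e) &
      \sum_(e <- es) importance Ts e <= mass_bound j].

Definition pass_inv (j : nat) (x : state) : Prop :=
  if (j < k)%N then spanner_inv j x else sampling_inv (j - k) x.

Hypothesis k0 : (0 < k)%N.
Hypothesis V_le : #|V|%:R <= 4 * M ^+ k.

Lemma inv_init : pass_inv 0 init.
Proof.
rewrite /pass_inv k0; split=> //=; first exact: near_center0.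
rewrite subn0; apply: le_trans V_le; rewrite ler_nat.
by apply: leq_trans (max_card _).
Qed.

Lemma foldl_update i ctr H L Ts (smp : cap.-bseq eitem) : (i < k)%N ->
  foldl (fun x e => update i e x) ((ctr, H, L, Ts, smp) : state) es =
  (ctr, H, foldl (fun L e => phase_insert vl K H ctr e L) L es, Ts, smp).
Proof. by move=> ik; elim: es L => [//|e es' IH] L /=; rewrite ik IH. Qed.

Hypothesis q0 : (0 < q)%N.
Hypothesis qM : 4 * M < q%:R.
Hypothesis qln : 8 * M * ln #|V|%:R <= q%:R.
Hypothesis K_ge : (2 * k.-1 + 1)%:R <= K.
Hypothesis NH_ge : (k * (#|V| * q) <= NH)%N.

Lemma spanner_step j x : (j < k)%N -> pass_inv j x ->
  wp j es (fun y => (~~ `[< pass_inv j.+1 y >])%:R) x <= 0.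
Proof.
move=> jk; rewrite {1}/pass_inv jk; case: x => [[[[ctr H] L] Ts] smp].
case=> sH Hes [-> -> ->] near im; rewrite wp_det; last first.
  by move=> e x; rewrite /prob jk.
rewrite foldl_update //; set L' := foldl _ _ _.
rewrite /finish jk.
have HL u : lightest (ctr \o other_end u) wt q
    [seq e <- es | unspanned_at vl K H u e] (L' u) by apply: phase_lightest.
have K_j : (2 * j + 1)%:R <= K.
  apply: le_trans K_ge; rewrite ler_nat leq_add2r leq_mul2l /=.
  by rewrite -ltnS prednK.
have sall : (size (all_items L') <= #|V| * q)%N.
  rewrite /all_items size_flatten /shape -map_comp sumnE big_map.
  rewrite cardE -sum1_size big_distrl /=; apply: leq_sum => u _.
  by rewrite mul1n; case: (L' u).
have sHL : (size (H ++ all_items L') <= j.+1 * (#|V| * q))%N.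
  by rewrite size_cat mulSn addnC leq_add.
have HE : btake NH (H ++ all_items L') = H ++ all_items L' :> seq _.
  apply: btakeE; apply: leq_trans sHL _; apply: leq_trans NH_ge.
  by rewrite leq_mul2r jk orbT.
have HH' : {subset H <= btake NH (H ++ all_items L')}.
  by move=> e eH; change (e \in (btake NH (H ++ all_items L') : seq eitem));
     rewrite HE mem_cat eH.
have LH' u : {subset (L' u) <= btake NH (H ++ all_items L')}.
  move=> e eL; change (e \in (btake NH (H ++ all_items L') : seq eitem)).
  rewrite HE mem_cat; apply/orP; right; apply/flattenP; exists (L' u : seq eitem) => //.
  by apply/mapP; exists u => //; rewrite mem_enum.
have He' : {subset btake NH (H ++ all_items L') <= es}.
  move=> e; change (e \in (btake NH (H ++ all_items L') : seq eitem) -> e \in es).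
  rewrite HE mem_cat => /orP[/Hes//|/flattenP[l /mapP[u _ ->]]] eL.
  by have [] := phase_item HL eL.
have M0 : 0 < M by apply: lt_trans M1.
rewrite asboolT //; rewrite /pass_inv; case: ltnP => jk'.
  have [ctr' [hit im']] := phase_centers HL s q0 im.
  have [good1 good2] : good_centers j ctr (fun u => L' u) (xget ctr (good_centers j ctr (fun u => L' u))).
    apply: xgetPex; exists ctr'; split=> //; apply: le_trans im' _.
    have -> : (k - j = (k - j.+1).+1)%N by rewrite -subSn.
    have Mm1 : 1 <= M ^+ (k - j.+1) by rewrite exprn_ege1 // ltW.
    (* With m = k - j - 1, the choice of [q] allows at most [M ^+ m + 2] new centers, and
       [1 <= M ^+ m] brings this below [4 * M ^+ m]. *)
    have : 4 * M ^+ (k - j.+1).+1 * ln #|V|%:R / q%:R <= M ^+ (k - j.+1).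
      rewrite ler_pdivrMr ?ltr0n // exprS.
      have Mm0 : 0 <= M ^+ (k - j.+1) by rewrite exprn_ge0 // ltW.
      have lnn : 0 <= ln #|V|%:R :> R.
        by apply: ln_ge0; rewrite ler1n; apply/card_gt0P; exists s.
      apply: le_trans (ler_wpM2l Mm0 qln).
      have : 0 <= M ^+ (k - j.+1) * (M * ln #|V|%:R) by rewrite !mulr_ge0 // ltW.
      by lra.
    by lra.
  split=> //; first by rewrite HE.
  exact: (phase_near es0 K_j near HL HH' LH' good1).
have jE : k = j.+1 by apply/eqP; rewrite eqn_leq jk' jk.
split=> //.
(* Before the last phase at most [4 * M] clusters remain, which is less than [q]. *)
- apply: (phase_last es0 K_j near HL HH' LH').
  rewrite -(ltr_nat R); apply: le_lt_trans im _.
  by rewrite jE subSnn expr1.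
- by rewrite jE subnn.
- rewrite jE subnn /mass_bound expr0 mulr1; apply: le_trans es_size.
  rewrite /importance /nviol /=; under eq_bigr do rewrite expr0.
  by rewrite big_const_seq count_predT iter_addr_0.
Qed.

Lemma wp_sample i c (smp : cap.-bseq eitem) f : (k <= i)%N ->
  wp i es f ((c, smp) : state) =
  sample (rate c.2) es (fun smp => f (finish i (c, smp))) smp.
Proof.
move=> ki; pose F (smp : cap.-bseq eitem) := f (finish i (c, smp)).
rewrite -/F; elim: es smp => [//|e es' IH] smp; rewrite wp_cons [RHS]/=.
have -> : prob i e (c, smp) = 1 - expR (- rate c.2 e) by rewrite /prob ltnNge ki.
have -> : update i e (c, smp) = (c, btake cap (e :: smp)).
  by case: c {F IH} => [[[ctr H] L] Ts]; rewrite /update ltnNge ki.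
by rewrite subKr -!IH.
Qed.

(** The largest fraction of the total that violated edges may carry: multiplying their importances
    by [M] then adds at most a fraction [gamma]. *)
Definition theta : R := gamma / M.

Definition heavy (Ts : seq tree) (T : tree) : bool :=
  theta * mass_bound (size Ts) < \sum_(e <- es | violated T e) importance Ts e.

Definition failure : R :=
  expR tau / 2 ^+ cap + #|{: tree}|%:R * expR (- (tau * theta)).

Lemma failure_ge0 : 0 <= failure.
Proof.
by rewrite addr_ge0 // mulr_ge0 ?expR_ge0 ?invr_ge0 ?exprn_ge0.
Qed.

(** Outside the events of [sample_net] the sample is complete and meets the violated edges of every
    heavy tree. The new tree violates no sampled edge, hence is not heavy, and the total importance
    grows by a factor at most [1 + gamma]. *)
Lemma sampling_step j x : (k <= j < k + r)%N -> pass_inv j x ->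
  wp j es (fun y => (~~ `[< pass_inv j.+1 y >])%:R) x <= failure.
Proof.
move=> /andP[kj jr]; rewrite {1}/pass_inv ltnNge kj /=.
case: x => [[[[ctr H] L] Ts] smp] [Hes sp [sT ->] Tgood mass].
rewrite wp_sample //=.
have B0 := mass_bound_gt0 (size Ts).
have rateE P : \sum_(e <- es | P e) rate Ts e =
    tau / mass_bound (size Ts) * \sum_(e <- es | P e) importance Ts e.
  by rewrite mulr_sumr; apply: eq_bigr => e _; rewrite /rate mulrAC.
apply: (@le_trans _ _ (sample (rate Ts) es (fun smp : cap.-bseq eitem =>
  ((size smp == cap) || [exists T : tree, heavy Ts T && ~~ has (violated T) smp])%:R)
  (btake cap [::]))); last first.
  apply: le_trans (sample_net cap (rate_ge0 Ts) (T := tree)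
    (A := fun T => violated T) (heavy := heavy Ts) (lambda := tau * theta) _) _.
    move=> T hT; rewrite rateE -mulrA ler_wpM2l //.
    by rewrite ler_pdivlMl // mulrC ltW.
  rewrite lerD2r ler_wpM2r ?invr_ge0 ?exprn_ge0 // ler_expR rateE.
  rewrite -mulrA ler_piMr // ler_pdivrMl // mulr1 sT.
  exact: mass.
apply: sample_le => [e|smp' smp'es]; first exact: rate_ge0.
case: asboolP => [_|ninv] /=; first by rewrite ler0n.
case: (boolP (_ || _)) => [_|]; first by [].
rewrite negb_or => /andP[_ /existsPn light]; exfalso; apply: ninv.
rewrite /pass_inv ltnNge (leqW kj) /= [(j < k)%N]ltnNge kj /=.
have smp'es' : {subset smp' <= es} by move=> e /smp'es; rewrite mem_cat in_nil.
have Fes : {subset smp' ++ H <= es}.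
  by move=> e; rewrite mem_cat => /orP[/smp'es'|/Hes].
have F0 e : e \in smp' ++ H -> 0 <= wt e by move/Fes/es0.
set T := sptree vl s (smp' ++ H).
have TsE : btake r (rcons Ts T) = rcons Ts T :> seq tree.
  apply: btakeE; rewrite size_rcons sT ltn_subLR //.
have TE T' : T' \in (btake r (rcons Ts T) : seq tree) -> T' = T \/ T' \in (Ts : seq tree).
  by rewrite TsE mem_rcons inE => /predU1P[->|]; [left|right].
split=> //.
- by rewrite TsE size_rcons sT subSn.
- move=> T' /TE[->|/Tgood//]; split.
    by have [sub _] := sptreeP s F0; move=> e /sub/Fes.
  have HF : {subset (H : seq eitem) <= smp' ++ H}.
    by move=> a aH; rewrite mem_cat; apply/orP; right.
  by move=> e ees; apply: sptree_stretch F0 HF (sp e ees).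
- rewrite TsE subSn //; apply: le_trans (importance_rcons vl s (ltW M1) es Ts T) _.
  have M0 : 0 < M by apply: lt_trans M1.
  have : ~~ heavy Ts T.
    have := light T; rewrite negb_and => /orP[//|/negPn/hasP[e eS]].
    by rewrite (negPf (sptree_not_violated s F0 _)) // mem_cat eS.
  rewrite -leNgt => nh; apply: le_trans (lerD mass (ler_wpM2l (ltW M0) nh)) _.
  have -> : M * (theta * mass_bound (size Ts)) = gamma * mass_bound (size Ts).
    by rewrite mulrA /theta [M * _]mulrC divfK // gt_eqF.
  rewrite sT /mass_bound exprS.
  by lra.
Qed.

Lemma failure_bound :
  wpr prob update finish es 0 (k + r) (fun y => (~~ `[< pass_inv (k + r) y >])%:R) init
    <= r%:R * failure.
Proof.
have := @wpr_invariant _ _ _ _ prob update finish prob_01 es pass_inv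
  (fun j => if (j < k)%N then 0 else failure) 0 (k + r) init.
rewrite add0n => le; apply: le_trans (le _ _ inv_init) _.
- move=> j y /andP[_ jr] iy; case: ifP => jk; first exact: spanner_step.
  by apply: sampling_step => //; rewrite leqNgt jk.
- by move=> j; case: ifP => // _; apply: failure_ge0.
rewrite (big_cat_nat (leq0n k) (leq_addr _ _)) /= big_nat big1 ?add0r; last first.
  by move=> j /andP[_ ->].
rewrite big_nat (eq_bigr (fun=> failure)); last by move=> j /andP[kj _]; rewrite ltnNge kj.
by rewrite -big_nat sumr_const_nat addKn mulr_natl.
Qed.

Variables (eps : R) (J : nat).
Hypothesis K1 : 1 <= K.
Hypothesis eps0 : 0 <= eps.
Hypothesis r0 : (0 < r)%N.
Hypothesis KJ : (K - 1) * J%:R <= r%:R * eps.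
Hypothesis mass_J : mass_bound r < M ^+ J.+1.

Lemma output_reach x : pass_inv (k + r) x ->
  exists T : seq eitem, [/\ {subset T <= es}, (output x).2 = [set ends e | e in T]%SET,
    is_tree (output x), s \in (output x).1 &
    forall t L, reach es s t L -> reach T s t ((1 + eps) * L)].
Proof.
rewrite /pass_inv ltnNge leq_addr /= addKn; case: x => [[[[ctr H] L] Ts] smp].
case=> Hes sp [sT _] Tgood mass.
set U := flatten (map val (Ts : seq tree)).
have Ues : {subset U <= es}.
  by move=> e /flattenP[l /mapP[T /Tgood[Tes _] ->]] /Tes.
have U0 e : e \in U -> 0 <= wt e by move/Ues/es0.
have : output_spec Ts (output (ctr, H, L, Ts, smp)).
  apply: xgetPex; have [T [X [TU _ tr sX pres]]] := spt_exists s U0.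
  by exists (X, [set ends e | e in T]%SET); exists T.
case=> T [TU T2 tr sT1 pres]; exists T; split=> //.
  by move=> e /TU/Ues.
move=> t l /(some_tree_good (J := J) es0 K1 eps0 (Ts := Ts)).
rewrite sT => /(_ r0 KJ)[].
- by move=> T' /Tgood[].
(* The importance [M ^+ nviol] of a single edge is at most the total, which is below [M ^+ J.+1]. *)
- move=> e ees; rewrite -ltnS; rewrite -(ltr_eXn2l M1); apply: le_lt_trans mass_J.
  apply: le_trans mass; rewrite (big_rem e) //= lerDl.
  by apply: sumr_ge0 => a _; apply: importance_ge0; apply: ltW.
move=> T' T'Ts /(reach_sub (T := U)) H'; apply/pres/H' => e eT.
by apply/flattenP; exists (val T') => //; apply: map_f.
Qed.

End Algorithm.

(** * From bounded walks to distances in the graph *)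

Section Graphs.
Variables (R : realType) (V : finType) (b : nat) (vl : word b -> R).
Notation eitem := (eitem V b).
Notation wt := (@wt R V b vl).
Notation reach := (@reach R V b vl).
Variable w : {set V} -> R.

Lemma reach_of_path (E : {set {set V}}) (es : seq eitem) x p :
  (forall f, f \in E -> exists2 e, e \in es & ends e = f) ->
  (forall e, e \in es -> wt e = w (ends e)) ->
  path (adj E) x p -> reach es x (last x p) (walk_weight w x p).
Proof.
move=> Ees esw; rewrite /walk_weight; elim: p x => [|y p IH] x /=.
  by rewrite big_nil => _; apply: reach_refl.
case/andP=> /Ees[e ees eE] /IH r; rewrite big_cons.
by apply: (reach_cons ees eE r); rewrite esw // eE.
Qed.

Lemma path_of_reach (T : seq eitem) x t l :
  (forall e, e \in T -> wt e = w (ends e)) -> reach T x t l ->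
  exists p, [/\ path (adj [set ends e | e in T]%SET) x p, last x p = t &
    walk_weight w x p <= l].
Proof.
move=> Tw; elim=> [z m m0|e y u z l1 l2 eT eE _ [p [pp lp wp]] le1].
  by exists [::]; split=> //; rewrite /walk_weight big_nil.
exists (u :: p); split=> //=.
  by rewrite pp andbT /adj -eE; apply/finset.imsetP; exists e.
rewrite /walk_weight /= big_cons; apply: le_trans le1.
by rewrite Tw // eE lerD2l.
Qed.

Lemma approx_of_reach (G : wgraph R V) (es T : seq eitem) s eps
    (Gr : graph_on V) : w = weight G -> 0 <= eps ->
  (forall f, f \in edges G -> exists2 e, e \in es & ends e = f) ->
  (forall e, e \in es -> ends e \in edges G /\ wt e = w (ends e)) ->
  {subset T <= es} -> Gr.2 = [set ends e | e in T]%SET -> is_tree Gr -> s \in Gr.1 ->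
  (forall t L, reach es s t L -> reach T s t ((1 + eps) * L)) ->
  approx_spt G s eps Gr.
Proof.
move=> wG eps0 Ges esG Tes Gr2 tr sGr ap; split=> //.
  apply/fintype.subsetP => f; rewrite Gr2 => /finset.imsetP[e /Tes/esG[eG _] ->].
  exact: eG.
have e1 : 0 < 1 + eps by rewrite ltr_wpDr.
(* Dividing by [1 + eps] leaves a lower bound to be checked for each walk of the graph; an
   unreachable [t] has no walk to check. *)
move=> t; rewrite muleC -lee_pdivrMr //; apply: le_ereal_inf_tmp => _ [p [pp lp ->]].
rewrite lee_pdivrMr // -EFinM.
have := reach_of_path Ges (fun e ees => proj2 (esG e ees)) pp.
rewrite lp => /ap /path_of_reach[e /Tes/esG[]//|p' [pp' lp' wp']].
apply: ereal_inf_le; exists (walk_weight (weight G) s p')%:E.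
  by exists p'; rewrite Gr2.
by rewrite lee_fin -wG mulrC.
Qed.

End Graphs.

(** * Counting states to bound the space *)

Section Cardinals.
Variables (V : finType) (b : nat).

Lemma card_bseq_le (T : finType) N : (#|{: N.-bseq T}| <= #|T|.+1 ^ N)%N.
Proof.
pose pad (x : N.-bseq T) := map Some x ++ nseq (N - size x) None.
have padP x : size (pad x) == N.
  by rewrite size_cat size_map size_nseq subnKC //; case: x.
pose f x : N.-tuple (option T) := Tuple (padP x).
have fI : injective f.
  have K x : pmap id (pad x) = x.
    rewrite pmap_cat (_ : pmap id (nseq _ _) = [::]); last by elim: (_ - _)%N.
    by rewrite cats0; elim: (bseqval x) => //= a l ->.
  by move=> x y /(congr1 val) /= E; apply: val_inj; rewrite /= -K -[RHS]K E.
by have := leq_card f fI; rewrite card_tuple card_option.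
Qed.

Lemma card_eitem_le (s : V) : (#|{: eitem V b}| <= #|V| ^ 2 * 2 ^ b)%N.
Proof.
pose a (e : eitem V b) := odflt s [pick x in ends e].
have aE e : a e \in ends e.
  rewrite /a; case: pickP => //= no; have [x [y eE]] := ends_set2 e.
  by move: (no x); rewrite eE !inE eqxx.
pose f (e : eitem V b) : V * V * word b := (a e, other_end (a e) e, (val e).2).
have fI : injective f.
  move=> e e' [E1 E2 E3]; apply: val_inj.
  apply: injective_projections => //; rewrite -!/(ends _).
  by rewrite (ends_other (aE e)) (ends_other (aE e')) E2 E1.
have := leq_card f fI; rewrite !card_prod card_tuple card_bool.
by rewrite -mulnn.
Qed.

Lemma leq_expl m n e : (m <= n -> m ^ e <= n ^ e)%N.
Proof. by case: e => // e mn; rewrite leq_exp2r. Qed.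

Lemma succ_leq_exp2 m e e' : (m <= 2 ^ e -> e < e' -> m < 2 ^ e')%N.
Proof. by move=> me ee; apply: leq_ltn_trans me _; rewrite ltn_exp2l. Qed.

Hypothesis b0 : (0 < b)%N.
Hypothesis Vb : (#|V| <= 2 ^ b)%N.

(** Two vertices and a weight fit in three words; a fourth absorbs the extra value that pads short
    lists. *)
Lemma card_items_le (s : V) N : (#|{: N.-bseq (eitem V b)}| <= 2 ^ (b * (4 * N)))%N.
Proof.
apply: leq_trans (card_bseq_le _ N) _; rewrite mulnA expnM; apply: leq_expl.
apply: (@succ_leq_exp2 _ (b * 3)); last by rewrite ltn_pmul2l.
apply: leq_trans (card_eitem_le s) _; rewrite mulnSr expnD leq_mul2r.
by rewrite expnM leq_expl ?orbT.
Qed.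

(** One summand for each component of the state, the last for the pass number. A tree takes
    [4 * #|V|] words, raised to [5 * #|V|] to absorb the padding of the list of trees. *)
Lemma card_state_le (s : V) (k q NH cap r : nat) :
  ((k + r).+1 * #|{: state V b q NH cap r}| <=
   2 ^ (b * (#|V| + 4 * NH + 4 * (q * #|V|) + 5 * (#|V| * r) + 4 * cap + (k + r))))%N.
Proof.
have n0 : (0 < #|V|)%N by apply/card_gt0P; exists s.
rewrite mulnC !card_prod !card_ffun.
have c1 : (#|V| ^ #|V| <= 2 ^ (b * #|V|))%N by rewrite expnM leq_expl.
have c2 := card_items_le s NH.
have c3 : (#|{: q.-bseq (eitem V b)}| ^ #|V| <= 2 ^ (b * (4 * (q * #|V|))))%N.
  by rewrite !mulnA expnM -mulnA leq_expl // card_items_le.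
have c4 : (#|{: r.-bseq (#|V|.-bseq (eitem V b))}| <= 2 ^ (b * (5 * (#|V| * r))))%N.
  apply: leq_trans (card_bseq_le _ r) _; rewrite !mulnA expnM; apply: leq_expl.
  apply: (@succ_leq_exp2 _ (b * (4 * #|V|))); first exact: card_items_le.
  by rewrite -mulnA ltn_pmul2l // ltn_pmul2r.
have c5 := card_items_le s cap.
have c6 : ((k + r).+1 <= 2 ^ (b * (k + r)))%N.
  apply: leq_trans (ltn_expl (k + r) (ltnSn 1)) _.
  by rewrite leq_exp2l // leq_pmull.
by have := leq_mul (leq_mul (leq_mul (leq_mul (leq_mul c1 c2) c3) c4) c5) c6;
   rewrite -!expnD -!mulnDr.
Qed.

End Cardinals.

(** * Numerical estimates for the parameters *)

Section Estimates.
Variable R : realType.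

Lemma expR_half_le2 : expR (2^-1) <= 2 :> R.
Proof.
have := expR_ge1Dx (- 2^-1 : R); rewrite expRN => h.
have e0 := expR_gt0 (2^-1 : R).
have : 2^-1 <= (expR 2^-1)^-1 :> R by apply: le_trans h; lra.
by rewrite lef_pV2 ?posrE.
Qed.

Lemma expR1_ge2 : 2 <= expR 1 :> R.
Proof. by have := expR_ge1Dx (1 : R); lra. Qed.

Lemma exp2_le_expR m : 2 ^+ m <= expR m%:R :> R.
Proof.
rewrite -[m%:R]mul1r expRM_natr lerXn2r ?nnegrE ?expR_ge0 //.
exact: expR1_ge2.
Qed.

Lemma expR_le_exp2 (x : R) m : 2 * x <= m%:R -> expR x <= 2 ^+ m.
Proof.
move=> xm; apply: (@le_trans _ _ (expR (2^-1 * m%:R))).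
  by rewrite ler_expR; lra.
by rewrite expRM_natr lerXn2r ?nnegrE ?expR_ge0 // expR_half_le2.
Qed.

Variables (n : nat) (l : R).
Hypothesis n_eq : n%:R = expR l.
Hypothesis l1 : 1 <= l.

Lemma nat_gt1 : (1 < n)%N.
Proof.
rewrite -(ltr_nat R) n_eq; apply: lt_le_trans (_ : 2 <= _); first by rewrite ltr1n.
by apply: le_trans expR1_ge2 _; rewrite ler_expR.
Qed.

(** From [2 ^ (up_log 2 n - 1) < n = exp l] and [exp x <= 2 ^ m] for [2 * x <= m], the logarithm is
    at most [2 * l + 1], and [1 <= l]. *)
Lemma word_size_le c : (word_size c n)%:R <= 3 * c%:R * l.
Proof.
have up : (up_log 2 n)%:R <= 3 * l :> R.
  have /andP[lt _] := up_log_bounds (ltnSn 1) nat_gt1.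
  have up0 : (0 < up_log 2 n)%N by rewrite up_log_gt0 ?nat_gt1.
  have : (up_log 2 n).-1%:R <= 2 * l :> R.
    rewrite leNgt; apply/negP => gt.
    have := expR_le_exp2 (ltW gt); rewrite -n_eq -natrX ler_nat leqNgt lt //.
  have upE : (up_log 2 n)%:R = (up_log 2 n).-1%:R + 1 :> R by rewrite natr1 prednK.
  have aux (u : R) : u <= 2 * l -> u + 1 <= 3 * l by have := l1; lra.
  by rewrite upE; apply: aux.
by rewrite /word_size natrM (mulrC 3) -mulrA ler_wpM2l.
Qed.

Variables (k r b cap m : nat).
Hypothesis k0 : (0 < k)%N.
Hypothesis kl : k%:R <= l.
Hypothesis rn : (r <= n ^ 5)%N.
Hypothesis r0 : (0 < r)%N.

Let M : R := expR (k%:R^-1 * l).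
Let gamma : R := k%:R / r%:R.
(** Chosen so that [tau * (gamma / M)] pays [4 * b * n] for the at most [2 ^ (4 * b * n)] trees of
    the union bound and keeps [8 * n * l] for the failure probability. *)
Let tau : R := r%:R * M / k%:R * (4 * (b * n)%:R + 8 * (n%:R * l)).

Lemma M_exp : M ^+ k = n%:R.
Proof. by rewrite /M -expRM_natr mulrAC mulVf ?mul1r // gt_eqF // ltr0n. Qed.

Lemma M_ge2 : 2 <= M.
Proof.
apply: le_trans expR1_ge2 _; rewrite ler_expR mulrC ler_pdivlMr ?ltr0n //.
by rewrite mul1r.
Qed.

(** [(1 + k / r) ^ r <= exp k <= n] because [k <= ln n], and [n ^ 3 = M ^ (3 k)]. *)
Lemma mass_bound_lt : mass_bound gamma (n%:R ^+ 2) r < M ^+ (3 * k).+1.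
Proof.
have M0 : 0 < M by apply: expR_gt0.
have g0 : 0 <= gamma by rewrite mulr_ge0 ?invr_ge0.
apply: (@le_lt_trans _ _ (M ^+ (3 * k))); last first.
  by rewrite ltr_eXn2l //; have := M_ge2; lra.
have -> : M ^+ (3 * k) = n%:R ^+ 2 * n%:R by rewrite mulnC exprM M_exp -exprSr.
rewrite /mass_bound ler_wpM2l ?exprn_ge0 // n_eq.
apply: (@le_trans _ _ (expR gamma ^+ r)).
  by rewrite lerXn2r ?nnegrE ?expR_ge0 ?addr_ge0 // expR_ge1Dx.
by rewrite -expRM_natr ler_expR /gamma divfK // gt_eqF // ltr0n.
Qed.

Lemma tau_theta : tau * (gamma / M) = 4 * (b * n)%:R + 8 * (n%:R * l).
Proof.
have M0 : M != 0 by rewrite gt_eqF // expR_gt0.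
have k1 : k%:R != 0 :> R by rewrite gt_eqF // ltr0n.
have r1 : r%:R != 0 :> R by rewrite gt_eqF // ltr0n.
by rewrite /tau /gamma; field; apply/and3P; split.
Qed.

Lemma tau_ge0 : 0 <= tau.
Proof.
have l0 : 0 <= l by apply: le_trans l1.
by rewrite !mulr_ge0 ?invr_ge0 ?expR_ge0 // addr_ge0 // !mulr_ge0.
Qed.

(** Overflow and union bound contribute at most [exp (- 8 n l)] each. The factor 2 is at most
    [exp 1] and [r <= n ^ 5 = exp (5 l)], so [exp (- n l)] remains. *)
Lemma failure_le : 2 * (tau + 8 * (n%:R * l)) <= cap%:R ->
  (m <= 2 ^ (b * (4 * n)))%N ->
  r%:R * (expR tau / 2 ^+ cap + m%:R * expR (- (tau * (gamma / M)))) <=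
    n%:R `^ (- (1 * n%:R)).
Proof.
move=> hcap hm; have hl1 := l1; set z := n%:R * l in hcap *.
have z0 : l <= z by rewrite /z ler_peMl ?(le_trans ler01) // ler1n ltnW // nat_gt1.
have p1 : expR tau / 2 ^+ cap <= expR (- (8 * z)).
  rewrite ler_pdivrMr ?exprn_gt0 //.
  apply: le_trans (ler_wpM2l (expR_ge0 _) (expR_le_exp2 hcap)).
  by rewrite -expRD ler_expR; lra.
have p2 : m%:R * expR (- (tau * (gamma / M))) <= expR (- (8 * z)).
  apply: (@le_trans _ _ (expR (4 * (b * n)%:R) * expR (- (tau * (gamma / M))))).
    rewrite ler_wpM2r ?expR_ge0 //.
    apply: (@le_trans _ _ ((2 ^ (b * (4 * n)))%:R)); first by rewrite ler_nat.
    rewrite natrX; apply: le_trans (exp2_le_expR _) _.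
    by rewrite ler_expR mulnCA natrM.
  by rewrite -expRD tau_theta ler_expR -/z; lra.
have rle : r%:R <= expR (5 * l).
  by rewrite mulrC expRM_natr -n_eq -natrX ler_nat.
have -> : n%:R `^ (- (1 * n%:R)) = expR (- z).
  rewrite /powR gt_eqF ?ltr0n ?(ltnW nat_gt1) //.
  by rewrite {2}n_eq expRK mul1r mulNr.
apply: (@le_trans _ _ (expR (5 * l) * (expR 1 * expR (- (8 * z))))).
  apply: ler_pM => //.
  apply: le_trans (lerD p1 p2) _.
  have := ler_wpM2r (expR_ge0 (- (8 * z))) expR1_ge2; lra.
by rewrite -!expRD ler_expR; lra.
Qed.

(** Every term is a multiple of [W = (r / k) n M l], using [k <= r / k], [k <= l] and [1 <= M]. The
    sample dominates with [4 * (2 * (12 c + 8) + 17)]; the other terms add [1 + 36 + 36 + 5 + 2]. *)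
Lemma space_le c q : b = word_size c n -> (k * k <= r)%N ->
  q = (Num.truncn (8 * M * l)).+1 ->
  cap = (Num.truncn (2 * (tau + 8 * (n%:R * l)))).+1 ->
  (n + 4 * (k * (n * q)) + 4 * (q * n) + 5 * (n * r) + 4 * cap + (k + r))%:R <=
    (96 * c%:R + 212) * (r%:R / k%:R * n%:R * M * l).
Proof.
move=> bE kr qE capE; have hl1 := l1; have hkl := kl.
set rho := r%:R / k%:R.
have k1 : 1 <= k%:R :> R by rewrite ler1n.
have kp : 0 < k%:R :> R by rewrite ltr0n.
have n1 : 1 <= n%:R :> R by rewrite ler1n ltnW // nat_gt1.
have M1 : 1 <= M by have := M_ge2; lra.
have rhok : k%:R <= rho by rewrite ler_pdivlMr // -natrM ler_nat.
have rho1 : 1 <= rho by apply: le_trans rhok.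
have rE : r%:R = rho * k%:R by rewrite /rho divfK // gt_eqF.
have mono (x y z t : R) : 0 <= x <= rho -> 0 <= y <= n%:R -> 0 <= z <= M ->
    0 <= t <= l -> x * y * z * t <= rho * n%:R * M * l.
  move=> /andP[? ?] /andP[? ?] /andP[? ?] /andP[? ?].
  by rewrite !ler_pM ?mulr_ge0.
set W := rho * n%:R * M * l.
have l0 : 0 <= l by lra.
have W1 : 1 <= W :> R.
  by have := mono 1 1 1 1; rewrite !mul1r; apply; rewrite ler01.
have nW : n%:R <= W :> R.
  have := mono 1 n%:R 1 1; rewrite mul1r !mulr1; apply; rewrite ?ler01 ?ler0n //.
  exact: lexx.
have nlW : n%:R * l <= W :> R.
  have := mono 1 n%:R 1 l; rewrite mul1r mulr1; apply; rewrite ?ler01 ?ler0n ?l0 ?lexx //.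
have nMlW : n%:R * M * l <= W :> R.
  have := mono 1 n%:R M l; rewrite mul1r; apply; rewrite ?ler01 ?ler0n ?l0 ?lexx //=; lra.
have knMlW : k%:R * n%:R * M * l <= W :> R.
  by apply: mono; rewrite ?ler01 ?ler0n ?l0 ?lexx //=; lra.
have rnW : n%:R * r%:R <= W :> R.
  have := mono rho n%:R 1 k%:R; rewrite mulr1 rE; have -> : n%:R * (rho * k%:R) = rho * n%:R * k%:R by ring.
  by apply; rewrite ?ler01 ?ler0n ?l0 ?lexx ?andbT //=; lra.
have rW : r%:R <= W :> R.
  have := mono rho 1 1 k%:R; rewrite !mulr1 -rE.
  by apply; rewrite ?ler01 ?ler0n ?l0 ?lexx ?andbT //=; lra.
have kr' : k%:R <= r%:R :> R.
  by rewrite ler_nat; apply: leq_trans kr; rewrite leq_pmull.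
have Ml1 : 1 <= M * l by rewrite mulr_ege1.
have q9 : q%:R <= 9 * (M * l) :> R.
  rewrite qE -natr1; have : (Num.truncn (8 * M * l))%:R <= 8 * M * l.
    by rewrite truncn_le !mulr_ge0 //; lra.
  lra.
have nqW : n%:R * q%:R <= 9 * W :> R.
  have : n%:R * q%:R <= n%:R * (9 * (M * l)) :> R by rewrite ler_wpM2l.
  lra.
have knqW : k%:R * (n%:R * q%:R) <= 9 * W :> R.
  have : k%:R * (n%:R * q%:R) <= k%:R * (n%:R * (9 * (M * l))).
    by rewrite !ler_wpM2l.
  lra.
have tauW : tau <= (12 * c%:R + 8) * W :> R.
  have bl : b%:R <= 3 * c%:R * l by rewrite bE word_size_le.
  have -> : tau = rho * M * (4 * (b%:R * n%:R) + 8 * (n%:R * l)).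
    by rewrite /tau natrM /rho; congr (_ * _); rewrite mulrAC.
  apply: (@le_trans _ _ (rho * M * (4 * (3 * c%:R * l * n%:R) + 8 * (n%:R * l)))).
    have rM : 0 <= rho * M by apply: mulr_ge0; lra.
    rewrite ler_wpM2l //.
    by rewrite lerD2r ler_wpM2l // ler_wpM2r.
  by rewrite /W le_eqVlt; apply/orP; left; apply/eqP; ring.
have capW : cap%:R <= 2 * tau + 17 * W :> R.
  have t0 := tau_ge0.
  rewrite capE -natr1; have : (Num.truncn (2 * (tau + 8 * (n%:R * l))))%:R <=
      2 * (tau + 8 * (n%:R * l)).
    by rewrite truncn_le mulr_ge0 // addr_ge0 // !mulr_ge0.
  lra.
rewrite !natrD !natrM; lra.
Qed.

End Estimates.

(** * Streams of a graph as lists of edge items *)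

Section Stream.
Variables (R : realType) (V : finType) (b : nat) (vl : word b -> R).
Variables (G : wgraph R V) (sigma : seq (item V b)).
Hypothesis str : stream_of vl G sigma.

Lemma stream_items : exists es : seq (eitem V b),
  [/\ map val es = sigma,
    forall f, f \in edges G -> exists2 e, e \in es & ends e = f,
    forall e, e \in es -> ends e \in edges G /\ wt vl e = weight G (ends e) &
    (size es <= #|V| ^ 2)%N].
Proof.
case: str => perm val_eq; have medge i : i \in sigma -> i.1 \in edges G.
  by move=> iS; rewrite -mem_enum -(perm_mem perm); apply: map_f.
have [es esE] : exists es : seq (eitem V b), map val es = sigma.
  have : all (fun i : item V b => #|i.1| == 2%N) sigma.
    by apply/allP => i /medge/edges_card2/eqP.
  elim: (sigma) => [|i l IH] /=; first by exists [::].
  by case/andP=> i2 /IH[es <-]; exists (exist _ i i2 :: es).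
have valS (e : eitem V b) : e \in es -> val e \in sigma.
  by rewrite -esE; apply: map_f.
exists es; split=> //.
- move=> f; rewrite -mem_enum -(perm_mem perm) -esE.
  by case/mapP=> i /mapP[e ees ->] ->; exists e.
- by move=> e /valS eS; split; [apply: medge eS|apply: val_eq].
have -> : size es = #|edges G|.
  by rewrite cardE -(perm_size perm) size_map -esE size_map.
have sub : edges G \subset [set A : {set V} | #|A| == 2%N]%SET.
  by apply/fintype.subsetP => f /edges_card2 f2; rewrite inE f2.
apply: leq_trans (subset_leq_card sub) _.
rewrite (_ : [set A : {set V} | #|A| == 2%N]%SET =
  [set A : {set V} | A \subset [set: V] & #|A| == 2%N]%SET); last first.
  by apply/finset.setP => A; rewrite !inE finset.subsetT.
rewrite cards_draws cardsT bin2 -divn2 -mulnn; apply: leq_trans (leq_div _ _) _.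
by rewrite leq_mul2l leq_pred orbT.
Qed.

End Stream.

(** * The guarantee for a given number [r] of sampling rounds *)

Lemma streaming_spt (R : realType) (c n k r : nat) (eps : R)
    (vl : word (word_size c n) -> R) (s : 'I_n) :
  (0 < c)%N -> (1 <= k)%N -> k%:R <= ln (n%:R : R) -> (k * k <= r)%N ->
  (r <= n ^ 5)%N -> 0 < eps -> ((2 * k.-1) * (3 * k))%:R <= r%:R * eps ->
  exists A : stream_alg R 'I_n (word_size c n),
    [/\ (sa_space A)%:R <= (96 * c%:R + 212) *
          (r%:R / k%:R * n%:R * expR (k%:R^-1 * ln (n%:R : R)) * ln (n%:R : R)),
        sa_passes A = (k + r)%N &
        forall (G : wgraph R 'I_n) (sigma : seq (item 'I_n (word_size c n))),
          stream_of vl G sigma ->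
          1 - n%:R `^ (- (1 * n%:R)) <=
            Pr (run A sigma) (fun m => approx_spt G s eps (sa_output m))].
Proof.
move=> c0 k0 kl kr rn eps0 Keps.
have n0 : (0 < n)%N := leq_ltn_trans (leq0n s) (ltn_ord s).
set l := ln (n%:R : R).
have nE : n%:R = expR l by rewrite /l lnK // posrE ltr0n.
have l1 : 1 <= l by apply: le_trans kl; rewrite ler1n.
have n1 := nat_gt1 nE l1.
set b := word_size c n in vl *.
have b0 : (0 < b)%N by rewrite muln_gt0 c0 up_log_gt0.
have r0 : (0 < r)%N by apply: leq_trans kr; rewrite muln_gt0 k0.
set M := expR (k%:R^-1 * l).
pose gamma : R := k%:R / r%:R.
pose tau : R := r%:R * M / k%:R * (4 * (b * n)%:R + 8 * (n%:R * l)).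
pose q := (Num.truncn (8 * M * l)).+1.
pose cap := (Num.truncn (2 * (tau + 8 * (n%:R * l)))).+1.
pose NH := (k * (n * q))%N.
pose K : R := (2 * k.-1 + 1)%:R.
have M2 : 2 <= M := M_ge2 k0 kl.
have M1 : 1 < M by lra.
have tau0 : 0 <= tau by apply: tau_ge0.
have g0 : 0 <= gamma by rewrite mulr_ge0 ?invr_ge0.
have N0 : 0 < n%:R ^+ 2 :> R by rewrite exprn_gt0 // ltr0n.
have Vb : (#|'I_n| <= 2 ^ b)%N.
  have /andP[_ up] := up_log_bounds (ltnSn 1) n1.
  by rewrite card_ord; apply: leq_trans up _; rewrite leq_exp2l // leq_pmull.
have p01 := prob_01 vl s k (q := q) (NH := NH) (cap := cap) (r := r) tau0 M1 g0 N0.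
have [A [Aspace Apasses AP]] := simulation
  (@update R 'I_n b vl K k q NH cap r) (@finish R 'I_n b vl s M k q NH cap r) p01
  (init 'I_n b q NH cap r) (@output R 'I_n b vl s q NH cap r)
  (card_state_le b0 Vb s k q NH cap r).
exists A; split=> //.
  by rewrite Aspace card_ord; apply: space_le.
move=> G sigma str; have [es [<- Ges esG sz]] := stream_items str.
have es0 e : e \in es -> 0 <= wt vl e.
  by move/esG=> [eG ->]; apply: weight_ge0.
have sz' : (size es)%:R <= n%:R ^+ 2 :> R.
  by rewrite -natrX ler_nat; move: sz; rewrite card_ord.
have q8 : 8 * M * l <= q%:R by rewrite ltW // truncnS_gt.
have MMl : M <= M * l by rewrite ler_peMr //; lra.
rewrite AP wpr_compl lerD2l lerN2.
apply: (@le_trans _ _ (r%:R * failure 'I_n b M tau gamma cap)); last first.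
  apply: failure_le => //; first by rewrite ltW // truncnS_gt.
  by apply: leq_trans (card_items_le b0 Vb s _) _; rewrite card_ord.
apply: le_trans (failure_bound s (K := K) (q := q) (NH := NH) cap r tau0 M1 g0 N0
  es0 sz' k0 _ _ _ _ _ _) => //.
- apply: (wpr_le _ _ p01) => x; case: asboolP => //= nap.
  case: asboolP => //= ok; exfalso; apply: nap.
  (* Here [K - 1 = 2 * (k - 1)] and each edge is violated at most [J = 3 * k] times, so [Keps] is
     the averaging condition of [some_tree_good]. *)
  have [||||T [Tes T2 tr sT ap]] := output_reach (J := 3 * k) M1 es0 (eps := eps) _ _ r0 _ _ ok.
  + by rewrite /K ler1n addn1.
  + exact: ltW.
  + by rewrite /K natrD addrK -natrM.
  + exact: mass_bound_lt.
  exact: (approx_of_reach (erefl (weight G)) (ltW eps0) Ges esG Tes T2 tr sT ap).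
- have Mk : M ^+ k = n%:R := M_exp nE k0.
  by rewrite card_ord Mk ler_peMl //; lra.
- by apply: lt_le_trans q8; lra.
- by rewrite card_ord.
- by rewrite card_ord.
Qed.

(** * Choice of the number of rounds *)

Theorem theorem4p1 (R : realType) (c : nat) (hc : (0 < c)%N) :
  exists Cspace Cpass delta : R,
    [/\ 0 < Cspace, 0 < Cpass, 0 < delta &
    forall (n k : nat) (eps : R) (val : word (word_size c n) -> R) (s : 'I_n),
      (1 <= k)%N -> k%:R <= ln (n%:R : R) -> 0 < eps < 1 ->
      exists A : stream_alg R 'I_n (word_size c n),
        [/\ (sa_space A)%:R <=
              Cspace * (k%:R / eps * n%:R `^ (1 + k%:R^-1) * ln n%:R),
            (sa_passes A)%:R <= Cpass * (k%:R ^+ 2 / eps) &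
            forall (G : wgraph R 'I_n) (sigma : seq (item 'I_n (word_size c n))),
              stream_of val G sigma ->
              1 - n%:R `^ (- (delta * n%:R)) <=
                Pr (run A sigma) (fun m => approx_spt G s eps (sa_output m))]].
Proof.
have C0 : 0 < 96 * c%:R + 212 :> R by rewrite ltr_wpDl // mulr_ge0.
(* The 7 comes from [r <= 7 * k ^ 2 / eps]; the 8 adds the [k] spanner passes. *)
exists (7 * (96 * c%:R + 212)), 8, 1; split=> //.
move=> n k eps vl s k1 kl /andP[e0 e1].
have n0 : (0 < n)%N := leq_ltn_trans (leq0n s) (ltn_ord s).
have nE : n%:R = expR (ln (n%:R : R)) by rewrite lnK // posrE ltr0n.
set l := ln (n%:R : R) in kl nE *.
have k1R : 1 <= k%:R :> R by rewrite ler1n.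
have l1 : 1 <= l by apply: le_trans kl.
have lp : 0 <= l by lra.
(* [n >= e >= (3 / 2) ^ 2 > 2]; later [n ^ 2 >= 9] absorbs the factor 7 in [r <= n ^ 5]. *)
have n3 : (2 < n)%N.
  rewrite -(ltr_nat R) nE; apply: (@lt_le_trans _ _ (expR 2^-1 * expR 2^-1)).
    have h : 3 / 2 <= expR 2^-1 :> R by apply: le_trans (expR_ge1Dx _); lra.
    by have := ler_pM (_ : 0 <= 3 / 2) (_ : 0 <= 3 / 2) h h; lra.
  by rewrite -expRD ler_expR; lra.
have n3R : 3 <= n%:R :> R by rewrite ler_nat.
set M := expR (k%:R^-1 * l).
have M1 : 1 <= M by have := M_ge2 k1 kl; rewrite -/M; lra.
have -> : n%:R `^ (1 + k%:R^-1) = n%:R * M :> R.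
  by rewrite /powR gt_eqF ?ltr0n // -/l mulrDl mul1r expRD -nE.
set D := k%:R ^+ 2 / eps.
have k2 : 1 <= k%:R ^+ 2 :> R by rewrite exprn_ege1.
have k2D : k%:R ^+ 2 <= D by rewrite ler_pdivlMr // ler_piMr ?exprn_ge0 // ltW.
have [small|large] := ltP (n%:R * eps) 1.
  (* With k = 1 the spanner already contains all distances, whatever eps is. *)
  have [||A [sp pa ok]] := @streaming_spt R c n 1 1 eps vl s hc isT l1 isT _ e0 _.
  - by rewrite expn_gt0 n0.
  - by rewrite /= mulr_ge0 // ltW.
  exists A; split=> //; last by rewrite pa; lra.
  apply: le_trans sp _; rewrite -/l !mulr1n invr1 !mul1r -nE.
  rewrite [7 * _]mulrC -[leRHS]mulrA ler_wpM2l ?(ltW C0) //.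
  (* Since [n < 1 / eps] here, the allowed space covers the quadratic space used for [k = 1]. *)
  apply: (@le_trans _ _ (1 * (n%:R * (n%:R * M) * l))).
    by rewrite mul1r ler_wpM2r // ler_wpM2l // ler_peMr.
  apply: ler_pM => //; [by rewrite !mulr_ge0 //; lra | by lra |].
  rewrite ler_wpM2r // ler_wpM2r ?mulr_ge0 //; first by lra.
  by rewrite ler_pdivlMr //; lra.
(* The averaging condition asks for [2 * (k - 1) * 3 * k <= r * eps], which [r >= 6 * k ^ 2 / eps]
   ensures. As [1 <= n * eps], also [D <= n ^ 3], whence [r <= n ^ 5]. *)
pose r := (Num.truncn (6 * D)).+1.
have D0 : 0 <= D by lra.
have rle : r%:R <= 7 * D.
  have : (Num.truncn (6 * D))%:R <= 6 * D by rewrite truncn_le mulr_ge0.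
  by rewrite /r -natr1; lra.
have rge : 6 * D <= r%:R by rewrite ltW // truncnS_gt.
have kn : k%:R <= n%:R :> R.
  by apply: le_trans kl _; rewrite nE; apply: le_trans (expR_ge1Dx _); lra.
have [|||A [sp pa ok]] := @streaming_spt R c n k r eps vl s hc k1 kl _ _ e0 _.
- rewrite -(ler_nat R) natrM -expr2; lra.
- rewrite -(ler_nat R) natrX; apply: le_trans rle _.
  have Dn : D <= n%:R ^+ 3.
    rewrite ler_pdivrMr // [n%:R ^+ 3]exprSr -mulrA; apply: (@le_trans _ _ (n%:R ^+ 2 * 1)).
      by rewrite mulr1 lerXn2r ?nnegrE.
    by rewrite ler_wpM2l // exprn_ge0.
  have n9 : 7 <= n%:R ^+ 2 :> R by rewrite expr2; nra.
  have -> : n%:R ^+ 5 = n%:R ^+ 2 * n%:R ^+ 3 :> R by rewrite -exprD.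
  by apply: ler_pM.
- apply: (@le_trans _ _ (6 * D * eps)); last by rewrite ler_wpM2r // ltW.
  rewrite /D -mulrA divfK ?gt_eqF // -natrX -natrM ler_nat.
  rewrite mulnACA -mulnn leq_mul //= leq_mul2r leq_pred orbT //.
exists A; split=> //.
  apply: le_trans sp _; rewrite -/l -/M [7 * _]mulrC -[leRHS]mulrA ler_wpM2l ?(ltW C0) //.
  rewrite -[_ * n%:R * M]mulrA !mulrA -mulrA -[leRHS]mulrA.
  have nMl : 0 <= n%:R * M * l by rewrite !mulr_ge0 //; lra.
  have rk : r%:R / k%:R <= 7 * (k%:R / eps).
    rewrite ler_pdivrMr ?ltr0n //; apply: le_trans rle _.
    have -> : D = k%:R / eps * k%:R by rewrite /D expr2 mulrAC.
    by rewrite mulrA.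
  by have := ler_wpM2r nMl rk; rewrite !mulrA.
rewrite pa natrD; have : k%:R <= D by apply: le_trans k2D; rewrite expr2 ler_peMr.
lra.
Qed.
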